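(* Let $\theta\geq 0$, $a\geq 0$, $b\geq 0$ with $ab<1$, and put $c=b(1-ab)^{-1}$. Then for every $\varphi\in\mathcal{L}^+_a$ and $f\in\mathcal{L}^+_b$ the function $\varphi(\Delta_\theta)f$ belongs to $\mathcal{L}^+_c$, and the map $(\varphi,f)\mapsto\varphi(\Delta_\theta)f$ is continuous from $\mathcal{L}^+_a\times\mathcal{L}^+_b$ (with the topology induced from $\mathcal{A}_a\times\mathcal{A}_b$) into $\mathcal{L}^+_c$ (with the topology induced from $\mathcal{A}_c$).
   Context: Let $\mathcal{E}$ be the set of entire functions. For $b>0$, $\|f\|_b=\sup_{k\in\mathbb{N}_0}b^{-k}|f^{(k)}(0)|$; for $a\geq0$, $\mathcal{A}_a=\{f\in\mathcal{E}:\|f\|_b<\infty\ \forall b>a\}$ with the locally convex topology generated by $\{\|\cdot\|_b: b>a\}$. $\mathcal{L}^+$ is the set of entire functions $f(z)=Cz^l e^{\alpha z}\prod_{j\ge1}(1+\beta_j z)$ with $C\in\mathbb{C}$, $l\in\mathbb{N}_0$, $\alpha\ge0$, $\beta_j\ge\beta_{j+1}\ge0$, $\sum_j\beta_j<\infty$; $\mathcal{L}^+_a=\mathcal{L}^+\cap\mathcal{A}_a$. For $\theta\ge0$, $\Delta_\theta$ is the differential operator $(\Delta_\theta f)(z)=\theta f'(z)+zf''(z)$. For entire $\varphi,f$, $\varphi(\Delta_\theta)f$ is the function $\sum_{k=0}^\infty\sum_{m=0}^\infty \frac{\varphi^{(k)}(0)}{k!}\frac{f^{(m)}(0)}{m!}\Delta_\theta^k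 z^m$ (note $\Delta_\theta^k z^m$ is a constant multiple of $z^{m-k}$ for $k\le m$ and $0$ for $k>m$). *)

(* Defs.v *)
From Stdlib Require Import Reals Factorial.
From Coquelicot Require Import Coquelicot.
Open Scope R_scope.

(* An entire function is represented by its Taylor coefficient sequence
   u : nat -> C at 0, i.e. f(z) = sum_k u k * z^k, convergent for every z. *)
Definition coefs := nat -> C.

Definition entire (u : coefs) : Prop :=
  forall z : C, ex_series (fun k => Cmult (u k) (Cpow z k)).

Definition deriv0 (u : coefs) (k : nat) : C := Cmult (RtoC (INR (fact k))) (u k).

Definition normb (b : R) (u : coefs) : Rbar :=
  Lub_Rbar (fun r => exists k : nat, r = / (b ^ k) * Cmod (deriv0 u k)).

Definition in_A (a : R) (u : coefs) : Prop :=
  entire u /\ forall b : R, a < b -> is_finite (normb b u).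

Fixpoint partial_prod (beta : nat -> R) (z : C) (n : nat) : C :=
  match n with
  | O => RtoC 1
  | S n' => Cmult (partial_prod beta z n') (Cplus (RtoC 1) (Cmult (RtoC (beta n')) z))
  end.

(* Laguerre–Pólya type class L^+ :
   f(z) = C z^l e^{alpha z} prod_{j>=1} (1 + beta_j z), with alpha >= 0,
   beta_j >= beta_{j+1} >= 0, sum beta_j < oo (indices shifted to start at 0).
   e^{alpha z} is the sum of its exponential series, the product is the limit
   of the partial products. *)
Definition in_Lplus (u : coefs) : Prop :=
  entire u /\
  exists (c0 : C) (l : nat) (alpha : R) (beta : nat -> R),
    0 <= alpha /\
    (forall j, 0 <= beta (S j) <= beta j) /\
    (forall j, 0 <= beta j) /\
    ex_series beta /\
    forall z : C, exists (E P : C),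
      is_series (fun k => Cmult (Cpow (Cmult (RtoC alpha) z) k) (RtoC (/ INR (fact k)))) E /\
      filterlim (partial_prod beta z) eventually (locally P) /\
      is_series (fun k => Cmult (u k) (Cpow z k))
                (Cmult (Cmult (Cmult c0 (Cpow z l)) E) P).

Definition in_Lplus_a (a : R) (u : coefs) : Prop := in_Lplus u /\ in_A a u.

(* Delta_theta^k z^m = dcoef theta k m * z^(m-k)   (0 when k > m),
   where Delta_theta z^m = m (m - 1 + theta) z^(m-1). *)
Fixpoint dcoef (theta : R) (k m : nat) : R :=
  match k with
  | O => 1
  | S k' => dcoef theta k' m * INR (m - k') * (INR (m - k') - 1 + theta)
  end.

Definition CSeries (v : nat -> C) : C :=
  (Series (fun k => fst (v k)), Series (fun k => snd (v k))).

(* The term of the double series contributing to the coefficient of z^n: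
   (phi^{(k)}(0)/k!) (f^{(n+k)}(0)/(n+k)!) * dcoef theta k (n+k). *)
Definition Dop_term (theta : R) (phi f : coefs) (n k : nat) : C :=
  Cmult (Cmult (phi k) (f (n + k)%nat)) (RtoC (dcoef theta k (n + k))).

Definition Dop (theta : R) (phi f : coefs) : coefs :=
  fun n => CSeries (Dop_term theta phi f n).

Definition csub (u v : coefs) : coefs := fun k => Cminus (u k) (v k).

(* Main.v *)
(* Continuity and the growth bound come from an explicit estimate: since
   Delta^k z^(n+k) = (n+k)!/n! (n+theta)_k z^n, the negative binomial series gives
   ||phi(Delta) f||_b3 <= (1 - b1 b2)^(-m) ||phi||_b1 ||f||_b2 as soon as
   b2/(1 - b1 b2) <= b3 and m >= theta is an integer.

   For membership in L^+, approximate phi and f from below, coefficient by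
   coefficient, by c z^l (1 + alpha z/n)^n prod_(j<n) (1 + beta_j z). If g has only
   nonpositive zeros, so has p g + q Delta g (p, q >= 0): for z = w^2 off (-oo, 0] with
   Re w > 0, put p_j = w/(w^2 + x_j), where -x_j are the zeros of g. All p_j lie in the
   right half plane, and (p g + q Delta g)(z)/g(z) divided by P = sum p_j is
   p/P + q theta/w + q (P^2 - sum p_j^2)/P, whose real part is positive
   unless p g + q Delta g = 0.
   So the approximants of phi(Delta) f have only nonpositive zeros, and a
   coefficientwise limit of normalized products prod_j (1 + b_(n,j) z) is
   e^(alpha z) prod_j (1 + beta_j z): extract b_(n,j) -> beta_j for all j; the tail of the
   product beyond J differs from the exponential of its sum by O(1/J), and alpha is
   the part of sum_j b_(n,j) that escapes to infinity. *)

Require Import Defs.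
From mathcomp Require all_boot all_order all_algebra complex Rstruct lra ring.
From Stdlib Require Import Reals Factorial Wf_nat Lra Lia.
From Stdlib Require Import ClassicalEpsilon FunctionalExtensionality.
From Coquelicot Require Import Coquelicot.
Open Scope R_scope.

(** Approximating from below serves twice. The numbers [dcoef] are nonnegative, so the terms of the
    series for the approximants stay below those for the limits, which are summable by the norm
    estimate, and dominated convergence applies. Moreover an approximant has no coefficient where
    the limit has none, so its order of vanishing at 0 is eventually that of the limit and the
    normalization makes sense. For this the complex constants are split off beforehand; what remains
    of a function in L^+ has nonnegative coefficients.

    Limits are taken coefficientwise with the series of [e^(s z)] as common majorant, in place of
    locally uniform convergence. The obstacle is that the sum over j need not converge to the sum of
    the limits; the error of trading a tail for an exponential is a sum of squares, which
    monotonicity in j makes small.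

    The radius c arises because the coefficient of z^n is bounded by a negative binomial series of
    exponent n + theta: the power n turns b2 into b2/(1 - b1 b2), and theta leaves a constant.
    Continuity then follows from bilinearity. *)

(* Power series are represented by their coefficient sequences: [shift] is
   multiplication by z, [mul_linear w] by 1 + w z, and [delta_comb theta p q] is the
   operator p + q Delta_theta. *)
Definition one_coef (k : nat) : R := match k with O => 1 | S _ => 0 end.

Definition shift (h : nat -> R) (k : nat) : R :=
  match k with O => 0 | S k' => h k' end.

Definition mul_linear (w : R) (h : nat -> R) (k : nat) : R := h k + w * shift h k.

Fixpoint prod_coef (beta : nat -> R) (n : nat) : nat -> R :=
  match n with O => one_coef | S n' => mul_linear (beta n') (prod_coef beta n') end.

Definition delta_comb (theta p q : R) (h : nat -> R) (k : nat) : R :=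
  p * h k + q * ((INR k + 1) * (INR k + theta) * h (S k)).

(** * Polynomials with nonpositive zeros *)

Module NonposRoots.
Set Implicit Arguments.
Unset Strict Implicit.
Import all_boot all_order all_algebra complex Rstruct.
Import ring lra.
Import Order.TTheory GRing.Theory Num.Theory.
Local Open Scope ring_scope.
Local Open Scope complex_scope.

Local Notation Re := complex.Re.
Local Notation Im := complex.Im.

Section Nonvanishing.
Variable K : rcfType.
Implicit Types (x y t : K) (xs : seq K) (z w p q : K[i]).

Definition rootprod (F : comNzRingType) (xs : seq F) : {poly F} :=
  \prod_(x <- xs) ('X + x%:P).

Definition delta (F : comNzRingType) (t : F) (f : {poly F}) : {poly F} :=
  t *: f^`() + 'X * f^`()^`().

Lemma rootprod_cons (F : comNzRingType) (x : F) (xs : seq F) :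
  rootprod (x :: xs) = ('X + x%:P) * rootprod xs.
Proof. by rewrite /rootprod big_cons. Qed.

Lemma rootprod_neq0 (xs : seq K) z :
  (forall x, x \in xs -> z + x%:C != 0) ->
  (map_poly (real_complex K) (rootprod xs)).[z] != 0.
Proof.
elim: xs => [|x xs IH] H; first by rewrite /rootprod big_nil rmorph1 hornerE oner_eq0.
rewrite rootprod_cons rmorphM rmorphD /= map_polyX map_polyC /= !hornerE.
rewrite mulf_neq0 //; first by apply: H; rewrite mem_head.
by apply: IH => y Hy; apply: H; rewrite inE Hy orbT.
Qed.

(** The logarithmic derivative of [f] is [A], and [f''/f = A^2 + A']; both identities are kept
    multiplied by [f(z)]. *)
Lemma rootprod_deriv xs z :
  (forall x, x \in xs -> z + x%:C != 0) ->
  let f := map_poly (real_complex K) (rootprod xs) in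
  let A := \sum_(x <- xs) (z + x%:C)^-1 in
  f^`().[z] = f.[z] * A /\
  f^`()^`().[z] = f.[z] * (A ^+ 2 - \sum_(x <- xs) (z + x%:C) ^- 2).
Proof.
elim: xs => [|x xs IH] H /=.
  rewrite /rootprod !big_nil rmorph1 derivC deriv0 !hornerE.
  by split; ring.
have [|IH1 IH2] := IH.
  by move=> y Hy; apply: H; rewrite inE Hy orbT.
have Hx : z + x%:C != 0 by apply: H; rewrite mem_head.
rewrite rootprod_cons rmorphM rmorphD /= map_polyX map_polyC /= !big_cons.
move: IH1 IH2; set f := map_poly _ _; set A := \sum_(_ <- _) _; set B := \sum_(_ <- _) _.
move=> IH1 IH2.
rewrite !(derivM, derivD, derivX, derivC, addr0, mul1r).
rewrite !(hornerD, hornerM, hornerX, hornerC) IH1 IH2.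
by split; field.
Qed.

Lemma sumRe (s : seq K[i]) : Re (\sum_(p <- s) p) = \sum_(p <- s) Re p.
Proof.
elim: s => [|p s IH]; first by rewrite !big_nil.
by rewrite !big_cons -IH; case: p; case: (\sum_(p <- s) p).
Qed.

Lemma sumIm (s : seq K[i]) : Im (\sum_(p <- s) p) = \sum_(p <- s) Im p.
Proof.
elim: s => [|p s IH]; first by rewrite !big_nil.
by rewrite !big_cons -IH; case: p; case: (\sum_(p <- s) p).
Qed.

(* With p_j = a_j + i b_j, A = sum a_j and B = sum b_j, the number E is
   A (A^2 - sum a_j^2) + sum (A - a_j) b_j^2 + sum a_j (B - b_j)^2. *)
Lemma Re_e2_conj_e1 (s : seq K[i]) :
  (forall p, p \in s -> 0 < Re p) ->
  let P := \sum_(p <- s) p in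
  let E := Re ((P ^+ 2 - \sum_(p <- s) p ^+ 2) * P^*%C) in
  0 <= E /\ ((1 < size s)%N -> 0 < E).
Proof.
move=> Hs P E.
pose A := \sum_(p <- s) Re p; pose B := \sum_(p <- s) Im p.
have HP : P = A +i* B by apply/eqP; rewrite eq_complex /A /B -sumRe -sumIm !eqxx.
have HE : E = A * (A ^+ 2 - \sum_(p <- s) Re p ^+ 2) +
    (\sum_(p <- s) ((A - Re p) * Im p ^+ 2 + Re p * (B - Im p) ^+ 2)).
  have H2 : \sum_(p <- s) p ^+ 2 =
      (\sum_(p <- s) Re p ^+ 2 - \sum_(p <- s) Im p ^+ 2)
      +i* (2 * \sum_(p <- s) Re p * Im p).
    elim: (s) => [|[a b] s' IH]; first by rewrite !big_nil mulr0 subr0.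
    rewrite !big_cons IH; apply/eqP; rewrite eq_complex /= !expr2 /=.
    by apply/andP; split; apply/eqP; ring.
  have H3 : \sum_(p <- s) ((A - Re p) * Im p ^+ 2 + Re p * (B - Im p) ^+ 2)
     = A * \sum_(p <- s) Im p ^+ 2 + B ^+ 2 * \sum_(p <- s) Re p
       - 2 * B * \sum_(p <- s) Re p * Im p.
    elim: (s) => [|p s' IH]; first by rewrite !big_nil; ring.
    by rewrite !big_cons IH; ring.
  by rewrite H3 -/A /E HP H2 expr2 /=; ring.
have HA : forall s' : seq K[i], (forall p, p \in s' -> 0 < Re p) ->
   0 <= \sum_(p <- s') Re p.
  move=> s' Hs'; rewrite big_seq; apply: sumr_ge0 => p /Hs'; exact: ltW.
have HAp : forall p, p \in s -> Re p <= A.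
  move=> p Hp; rewrite /A (big_rem p Hp) /= lerDl.
  by apply: HA => q /mem_rem; apply: Hs.
have Hsum2 : 0 <= \sum_(p <- s) ((A - Re p) * Im p ^+ 2 + Re p * (B - Im p) ^+ 2).
  rewrite big_seq; apply: sumr_ge0 => p Hp.
  apply: addr_ge0; apply: mulr_ge0; rewrite ?sqr_ge0 ?subr_ge0 ?HAp //.
  by apply: ltW; apply: Hs.
have Hsq : forall s' : seq K[i], (forall p, p \in s' -> 0 < Re p) ->
   \sum_(p <- s') Re p ^+ 2 <= (\sum_(p <- s') Re p) ^+ 2.
  elim=> [|p s' IH] H; first by rewrite !big_nil expr0n.
  have Hp : 0 < Re p by apply: H; rewrite mem_head.
  have H' : forall p, p \in s' -> 0 < Re p.
    by move=> q Hq; apply: H; rewrite inE Hq orbT.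
  rewrite !big_cons; have := IH H'; have := HA _ H'.
  move: (\sum_(_ <- _) _) (\sum_(_ <- _) _) (Re p) Hp => u v r Hr Hu Hv; nra.
have HA0 : 0 <= A by apply: HA.
split.
  rewrite HE; apply: addr_ge0 => //; apply: mulr_ge0 => //.
  by rewrite subr_ge0 Hsq.
(* For strictness the first summand is enough: with two terms, [A^2 - sum a_j^2] contains the cross
   term [2 a_1 a_2]. *)
move=> Hsz; rewrite HE; apply: ltr_pwDl => //.
rewrite {Hsum2 HE HAp HP E P B}/A in HA0 *.
case: s Hs Hsz {HA0} => [|p [|q s]] //= Hs _.
have Hp : 0 < Re p by apply: Hs; rewrite mem_head.
have Hq : 0 < Re q by apply: Hs; rewrite inE mem_head orbT.
have H' : forall p, p \in s -> 0 < Re p.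
  by move=> r Hr; apply: Hs; rewrite !inE Hr !orbT.
rewrite !big_cons; have := Hsq _ H'; have := HA _ H'.
move: (\sum_(_ <- _) _) (\sum_(_ <- _) _) (Re p) (Re q) Hp Hq => u v r1 r2 H1 H2 Hu Hv.
apply: mulr_gt0; first lra.
rewrite subr_gt0; nra.
Qed.


Lemma Re_inv_gt0 w : 0 < Re w -> 0 < Re w^-1.
Proof.
case: w => a b /= Ha.
by rewrite divr_gt0 // ltr_pwDl // ?exprn_gt0 // sqr_ge0.
Qed.

(** A root [w] with [Re w = 0] would have the square [- (Im w)^2], on the excluded half line;
    otherwise [w] or [- w] serves. *)
Lemma right_sqrt z : ~~ ((Re z <= 0) && (Im z == 0)) ->
  exists2 w, w ^+ 2 = z & 0 < Re w.
Proof.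
move=> Hz; pose w := sqrtC z.
have Hw : w ^+ 2 = z by rewrite sqrtCK.
case: (ltrgtP (Re w) 0) => Hr; last first.
- exfalso; move: Hz; rewrite -Hw; case: (w) Hr => a b /= ->.
  by rewrite !mul0r mulr0 addr0 eqxx andbT sub0r oppr_le0 -expr2 sqr_ge0.
- by exists w.
- exists (- w); first by rewrite sqrrN.
  by case: (w) Hr => a b /= Hr; rewrite oppr_gt0.
Qed.

(** The quotient [g(z)/f(z)] is multiplied by the conjugate of [P] instead of divided by [P], which
    vanishes when there are no zeros. The real part is then a sum of three nonnegative terms, so
    each is zero; the cases where this can happen all give [g = 0]. *)
Lemma delta_comb_root xs t (a b : K) z :
  {in xs, forall x, 0 <= x} -> 0 <= t -> 0 <= a -> 0 <= b ->
  let g := a *: rootprod xs + b *: delta t (rootprod xs) in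
  root (map_poly (real_complex K) g) z ->
  ~~ ((Re z <= 0) && (Im z == 0)) -> g = 0.
Proof.
move=> Hxs Ht Ha Hb g Hroot Hz.
have [w Hw Hrw] := right_sqrt Hz.
have Hzx x : x \in xs -> z + x%:C != 0.
  move=> /Hxs Hx; apply: contra Hz; rewrite addr_eq0 => /eqP ->.
  by rewrite /= oppr0 eqxx oppr_le0 Hx.
have [] := rootprod_deriv Hzx; set f := map_poly _ _.
set A := \sum_(_ <- _) _; set B := \sum_(_ <- _) _ => H1 H2.
have Hf : f.[z] != 0 by apply: rootprod_neq0.
pose s := [seq w / (z + x%:C) | x <- xs].
pose P := \sum_(p <- s) p.
have HP : P = w * A by rewrite /P /A big_map big_distrr.
have HQ : \sum_(p <- s) p ^+ 2 = z * B.
  rewrite big_map big_distrr /=; apply: eq_bigr => x _.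
  by rewrite -Hw exprMn exprVn.
have Hw0 : w != 0 by apply/eqP => E; rewrite E ltxx in Hrw.
(* The inverse of [w / (w^2 + x)] is [w + x / w], where both summands have nonnegative real part and
   the first a positive one. *)
have Hs p : p \in s -> 0 < Re p.
  move=> /mapP [x Hx ->]; rewrite -invf_div; apply: Re_inv_gt0.
  rewrite -Hw mulrDl expr2 mulfK //.
  have := Re_inv_gt0 Hrw; have := Hxs _ Hx; move: (w^-1) Hrw => [c d] /=.
  case: (w) => c' d' /=; rewrite mul0r subr0 => *.
  by rewrite ltr_pwDl // mulr_ge0 // ltW.
pose U := P ^+ 2 - z * B; pose E := Re (U * P^*%C).
have [HE0 HE1] : 0 <= E /\ ((1 < size xs)%N -> 0 < E).
  by have := Re_e2_conj_e1 Hs; rewrite /= -/P HQ size_map.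
(* Division of [g(z) = 0] by [f(z)], with [f'/f = P / w] and [z f''/f = U]. *)
have Heq : a%:C + b%:C * (t%:C * (P / w) + U) = 0.
  apply: (mulfI Hf); rewrite mulr0.
  move: Hroot; rewrite /root /g /delta => /eqP <-.
  rewrite !(rmorphD, rmorphM) /= !(map_polyZ, map_polyX, rmorphD, rmorphM) /=.
  rewrite !(map_polyZ, map_polyX, rmorphD, rmorphM) /= -!deriv_map -/f.
  rewrite !(hornerD, hornerM, hornerX, hornerZ) H1 H2 /U HP -Hw.
  by field.
have Hsum : a * Re P + b * t * ((Re P ^+ 2 + Im P ^+ 2) * Re w^-1) + b * E = 0.
  have : Re ((a%:C + b%:C * (t%:C * (P / w) + U)) * P^*%C) = 0.
    by rewrite Heq mul0r.
  rewrite /E; move: (U) (P) (w^-1) => [u1 u2] [v1 v2] [w1 w2] /= Hre.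
  by rewrite -[RHS]Hre; ring.
have HsP : (0 < size xs)%N -> 0 < Re P.
  rewrite /P sumRe -(size_map (fun x => w / (z + x%:C))) -/s.
  case: (s) Hs => [|q s'] // Hs _.
  rewrite big_cons ltr_pwDl //; first by apply: Hs; rewrite mem_head.
  rewrite big_seq; apply: sumr_ge0 => p Hp; apply: ltW; apply: Hs.
  by rewrite inE Hp orbT.
(* Without zeros [g] is the constant [a], which [Heq] makes zero. *)
have [Hsz|Hsz] := posnP (size xs).
  move/size0nil: Hsz => Exs.
  have P0 : P = 0 by rewrite /P /s Exs big_nil.
  have B0 : B = 0 by rewrite /B Exs big_nil.
  move: Heq; rewrite /U P0 B0 expr0n mul0r !mulr0 subr0 addr0 mulr0 addr0.
  move=> [a0]; rewrite /g a0 Exs /rootprod big_nil /delta derivC deriv0.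
  by rewrite scale0r scaler0 mulr0 addr0 scaler0 addr0.
have HP0 := HsP Hsz.
have Hi : 0 < (Re P ^+ 2 + Im P ^+ 2) * Re w^-1.
  by rewrite mulr_gt0 ?Re_inv_gt0 // ltr_pwDl ?sqr_ge0 // exprn_gt0.
have [HbE [HaP HtP]] : b * E = 0 /\ a * Re P = 0 /\
    b * t * ((Re P ^+ 2 + Im P ^+ 2) * Re w^-1) = 0.
  have := mulr_ge0 Ha (ltW HP0).
  have := mulr_ge0 (mulr_ge0 Hb Ht) (ltW Hi).
  have := mulr_ge0 Hb HE0; move: Hsum.
  move: (a * _) (b * E) (b * t * _) => u1 u2 u3; lra.
have a0 : a = 0 by move/eqP: HaP; rewrite mulf_eq0 (gt_eqF HP0) orbF => /eqP.
have [b0|b0] := eqVneq b 0; first by rewrite /g a0 b0 !scale0r addr0.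
have t0 : t = 0.
  by move/eqP: HtP; rewrite mulf_eq0 (gt_eqF Hi) orbF mulf_eq0 (negPf b0) => /eqP.
(* Left over: [a = 0], [t = 0] and a single zero, where [z f''] vanishes because [f] is linear. *)
have Hsz1 : size xs = 1%N.
  apply/eqP; rewrite eqn_leq Hsz andbT leqNgt; apply/negP => /HE1 HE.
  by move/eqP: HbE; rewrite mulf_eq0 (negPf b0) (gt_eqF HE).
rewrite /g a0 t0; case: (xs) Hsz1 => [|x [|]] // _.
rewrite /rootprod big_seq1 /delta derivD derivX derivC addr0 derivC.
by rewrite !scale0r mulr0 addr0 scaler0 addr0.
Qed.

(** All complex roots being real and nonpositive, the factorization over the algebraically closed
    [K[i]] comes from one over [K], recovered by injectivity of [map_poly]. The value [c = 0] covers
    [g = 0], which occurs when [Delta] meets a constant. *)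
Lemma delta_comb_rootprod xs t (a b : K) :
  {in xs, forall x, 0 <= x} -> 0 <= t -> 0 <= a -> 0 <= b ->
  exists c ys, {in ys, forall y : K, 0 <= y} /\
    a *: rootprod xs + b *: delta t (rootprod xs) = c *: rootprod ys.
Proof.
move=> Hxs Ht Ha Hb; pose g := a *: rootprod xs + b *: delta t (rootprod xs); rewrite -/g.
have [g0|g0] := eqVneq g 0.
  by exists 0, [::]; split=> //; rewrite g0 scale0r.
have [rs Hrs] := closed_field_poly_normal (map_poly (real_complex K) g).
have Hr r : r \in rs -> (Re r <= 0) && (Im r == 0).
  move=> Hr; apply/negPn/negP => Hn; move: (g0) => /negP; apply; apply/eqP.
  apply: (delta_comb_root Hxs Ht Ha Hb _ Hn).
  rewrite Hrs rootZ ?lead_coef_eq0 ?map_poly_eq0 //.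
  by rewrite root_prod_XsubC.
pose ys := [seq - Re r | r <- rs]; pose c := lead_coef g.
exists c, ys; split.
  by move=> y /mapP [r /Hr /andP [Hr0 _] ->]; rewrite oppr_ge0.
apply: (@map_poly_inj _ _ (real_complex K)); rewrite Hrs map_polyZ lead_coef_map /=.
congr (_ *: _); rewrite /rootprod big_map rmorph_prod /=.
rewrite big_seq [RHS]big_seq; apply: eq_bigr => r /Hr /andP [_ /eqP Hi].
rewrite rmorphD /= map_polyX map_polyC /=; congr (_ + _).
by rewrite -polyCN; congr (_ %:P); case: r Hi => u v /= ->;
  apply/eqP; rewrite eq_complex /= oppr0 !eqxx.
Qed.

End Nonvanishing.

(** * Coefficient sequences of polynomials with nonpositive zeros *)

Definition rooted (h : nat -> R) : Prop :=
  exists (c : R) (xs : seq R), {in xs, forall x, 0 <= x} /\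
    forall k, h k = (c *: rootprod xs)`_k.

Lemma rooted_one_coef : rooted one_coef.
Proof.
exists 1, [::]; split=> // -[|k]; rewrite /rootprod big_nil scale1r coefC //.
Qed.

Lemma rooted_shift h : rooted h -> rooted (shift h).
Proof.
move=> [c [xs [Hxs Hh]]]; exists c, (0 :: xs); split.
  by move=> x; rewrite inE => /orP [/eqP -> //|/Hxs].
move=> k; rewrite rootprod_cons addr0 scalerAr coefXM.
by case: k => [|k] //=.
Qed.

Lemma rooted_mul_linear w h : Rle 0 w -> rooted h -> rooted (mul_linear w h).
Proof.
move=> /RleP Hw [c [xs [Hxs Hh]]].
have Hm k : mul_linear w h k = ((1 + w *: 'X) * (c *: rootprod xs))`_k.
  move: (c *: _) Hh => f Hh; rewrite /mul_linear RplusE RmultE mulrDl mul1r coefD -scalerAl coefZ coefXM -Hh.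
  by case: k => [|k] /=; rewrite ?Hh.
(* [1 + w X = w (X + w^-1)] requires a nonzero [w]; otherwise the factor is 1. *)
have [w0|w0] := eqVneq w 0.
  exists c, xs; split=> // k.
  by rewrite Hm w0 scale0r addr0 mul1r.
exists (w * c), (w^-1 :: xs); split.
  by move=> x; rewrite inE => /orP [/eqP ->|/Hxs //]; rewrite invr_ge0.
move=> k; rewrite Hm rootprod_cons.
suff -> : (1 + w *: 'X) * (c *: rootprod xs) =
    (w * c) *: (('X + (w^-1)%:P) * rootprod xs) by [].
rewrite -scalerA scalerAr [RHS]scalerAl scalerDr; congr (_ * _).
by rewrite addrC -[w *: _%:P]mul_polyC -polyCM mulfV.
Qed.

Lemma rooted_delta_comb theta p q h :
  Rle 0 theta -> Rle 0 p -> Rle 0 q -> rooted h -> rooted (delta_comb theta p q h).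
Proof.
move=> /RleP Ht /RleP Hp /RleP Hq [c [xs [Hxs Hh]]].
have [c' [ys [Hys E]]] := delta_comb_rootprod Hxs Ht Hp Hq.
exists (c * c'), ys; split=> // k.
rewrite -scalerA -E /delta_comb !Hh !RplusE !RmultE !INRE ?R1E.
rewrite !coefZ coefD !coefZ /delta coefD coefZ coefXM !coef_deriv.
case: k => [|k]; rewrite ?coef_deriv /=; first by rewrite mulr1n; ring.
by ring.
Qed.

Lemma prod_coef_prod (ys : seq R) k :
  prod_coef (nth 0 ys) (size ys) k = (\prod_(y <- ys) (1 + y *: 'X))`_k.
Proof.
have eq_prod_coef b1 b2 n : (forall j, (j < n)%N -> b1 j = b2 j) -> prod_coef b1 n = prod_coef b2 n.
  elim: n => [|n IH] H //=; rewrite IH ?H // => j Hj; apply: H; exact: ltnW.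
elim/last_ind: ys k => [|ys y IH] k.
  by rewrite big_nil coefC; case: k.
rewrite size_rcons /= nth_rcons ltnn eqxx -cats1 big_cat big_seq1 /=.
rewrite (eq_prod_coef _ (nth 0 ys)); last by move=> j Hj; rewrite nth_cat Hj.
rewrite /mul_linear RplusE RmultE mulrDr mulr1 coefD -scalerAr coefZ coefMX -IH.
by case: k => [|k] /=; rewrite ?IH.
Qed.

(** A zero [- x] with [x > 0] contributes [X + x = x (1 + x^-1 X)], a zero at the origin a factor
    [X]. *)
Lemma rootprod_split (xs : seq R) : {in xs, forall x, 0 <= x} ->
  exists c l (ys : seq R), {in ys, forall y, 0 <= y} /\
    rootprod xs = c *: ('X^l * \prod_(y <- ys) (1 + y *: 'X)).
Proof.
elim: xs => [|x xs IH] H.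
  by exists 1, 0%N, [::]; split=> //; rewrite /rootprod !big_nil expr0 mulr1 scale1r.
have [|c [l [ys [Hys E]]]] := IH; first by move=> y Hy; apply: H; rewrite inE Hy orbT.
rewrite rootprod_cons E; have [x0|x0] := eqVneq x 0.
  by exists c, l.+1, ys; split=> //; rewrite x0 addr0 -scalerAr mulrA exprS.
exists (x * c), l, (x^-1 :: ys); split.
  move=> y; rewrite inE => /orP [/eqP ->|/Hys //].
  by rewrite invr_ge0; apply: H; rewrite mem_head.
have -> : 'X + x%:P = x *: (1 + x^-1 *: 'X).
  by rewrite scalerDr scalerA mulfV // scale1r addrC -mul_polyC mulr1.
rewrite big_cons -scalerAl -scalerAr scalerA; congr (_ *: _).
by rewrite mulrCA.
Qed.

Lemma iter_shift_coef l h (f : {poly R}) k :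
  (forall k, h k = f`_k) -> Nat.iter l shift h k = ('X^l * f)`_k.
Proof.
move=> Hf; elim: l k => [|l IH] k; first by rewrite expr0 mul1r.
by rewrite exprS -mulrA coefXM; case: k => [|k] //=.
Qed.

Lemma rooted_sorted h : rooted h ->
  exists (c : R) (l : nat) (beta : nat -> R) (N : nat),
    (forall j, Rle 0 (beta (S j)) /\ Rle (beta (S j)) (beta j)) /\
    (forall j, (N <= j)%coq_nat -> beta j = 0) /\
    forall k, h k = Rmult c (Nat.iter l shift (prod_coef beta N) k).
Proof.
move=> [c [xs [Hxs Hh]]]; have [c' [l [ys [Hys E]]]] := rootprod_split Hxs.
pose s := sort >=%O ys.
have Hs : sorted >=%O s by apply: sort_sorted => x y; exact: le_total.
have Hs0 j : 0 <= nth 0 s j.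
  case: (ltnP j (size s)) => Hj; last by rewrite nth_default.
  by apply: Hys; rewrite -(mem_sort >=%O); apply: mem_nth.
(* Sorting gives the decreasing order that L^+ demands, and the default 0 of [nth] continues the
   list without breaking it. *)
exists (c * c'), l, (nth 0 s), (size s); split; last split.
- move=> j; split; first by apply/RleP.
  apply/RleP; case: (ltnP j.+1 (size s)) => Hj.
    by move/sortedP: Hs => Hs; apply: Hs.
  by rewrite nth_default.
- by move=> j /ssrnat.leP Hj; rewrite nth_default.
- move=> k; rewrite Hh E scalerA coefZ RmultE; congr (_ * _).
  rewrite (iter_shift_coef _ _ (prod_coef_prod s)).
  suff -> : \prod_(y <- ys) (1 + y *: 'X) = \prod_(y <- s) (1 + y *: 'X :> {poly R}) by [].
  by apply: perm_big; rewrite perm_sym perm_sort.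
Qed.

End NonposRoots.

(** * Complex series and dominated convergence *)

(** Componentwise form of filter convergence (see [Ccv_filterlim]), so that the limit theorems for
    real sequences apply. *)
Definition Ccv (u : nat -> C) (l : C) : Prop :=
  is_lim_seq (fun n => fst (u n)) (fst l) /\ is_lim_seq (fun n => snd (u n)) (snd l).

Lemma Ccv_filterlim u l : filterlim u eventually (locally l) <-> Ccv u l.
Proof.
split.
- intros H; split.
  + apply (filterlim_comp _ _ _ u fst eventually (locally l) (locally (fst l)) H).
    intros P [d Hd]; exists d; intros y [Hy _]; now apply Hd.
  + apply (filterlim_comp _ _ _ u snd eventually (locally l) (locally (snd l)) H).
    intros P [d Hd]; exists d; intros y [_ Hy]; now apply Hd.
- intros [H1 H2] P [d Hd].
  assert (E1 := H1 _ (locally_ball (fst l) d)).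
  assert (E2 := H2 _ (locally_ball (snd l) d)).
  unfold filtermap in *.
  generalize (filter_and _ _ E1 E2); apply filter_imp.
  intros n [A B]; apply Hd; now split.
Qed.

Lemma fst_sum_n (a : nat -> C) n : fst (sum_n a n) = sum_n (fun k => fst (a k)) n.
Proof.
induction n as [|n IH]; [now rewrite !sum_O|].
rewrite !sum_Sn, <- IH; reflexivity.
Qed.

Lemma snd_sum_n (a : nat -> C) n : snd (sum_n a n) = sum_n (fun k => snd (a k)) n.
Proof.
induction n as [|n IH]; [now rewrite !sum_O|].
rewrite !sum_Sn, <- IH; reflexivity.
Qed.

Lemma Cis_series (a : nat -> C) (l : C) :
  is_series a l <->
  is_series (fun k => fst (a k)) (fst l) /\ is_series (fun k => snd (a k)) (snd l).
Proof.
unfold is_series at 1; rewrite Ccv_filterlim; unfold Ccv, is_series.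
split; intros [H1 H2]; split.
- eapply filterlim_ext; [|exact H1]; intros n; apply fst_sum_n.
- eapply filterlim_ext; [|exact H2]; intros n; apply snd_sum_n.
- eapply filterlim_ext; [|exact H1]; intros n; symmetry; apply fst_sum_n.
- eapply filterlim_ext; [|exact H2]; intros n; symmetry; apply snd_sum_n.
Qed.

Lemma Ccv_unique u l1 l2 : Ccv u l1 -> Ccv u l2 -> l1 = l2.
Proof.
intros [A1 B1] [A2 B2]; destruct l1 as [x1 y1], l2 as [x2 y2]; simpl in *.
assert (E1 := is_lim_seq_unique _ _ A1); rewrite (is_lim_seq_unique _ _ A2) in E1.
assert (E2 := is_lim_seq_unique _ _ B1); rewrite (is_lim_seq_unique _ _ B2) in E2.
now inversion E1; inversion E2; subst.
Qed.

Lemma Cis_series_unique (a : nat -> C) (l1 l2 : C) :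
  is_series a l1 -> is_series a l2 -> l1 = l2.
Proof. intros H1 H2; eapply Ccv_unique; apply Ccv_filterlim; eassumption. Qed.

Lemma Ccv_const (c : C) : Ccv (fun _ => c) c.
Proof. split; apply is_lim_seq_const. Qed.

Lemma Ccv_minus u v l m : Ccv u l -> Ccv v m ->
  Ccv (fun n => Cminus (u n) (v n)) (Cminus l m).
Proof. intros [A B] [A' B']; split; now apply is_lim_seq_minus'. Qed.

Lemma Ccv_plus u v l m : Ccv u l -> Ccv v m ->
  Ccv (fun n => Cplus (u n) (v n)) (Cplus l m).
Proof. intros [A B] [A' B']; split; now apply is_lim_seq_plus'. Qed.

Lemma Ccv_mult u v l m : Ccv u l -> Ccv v m ->
  Ccv (fun n => Cmult (u n) (v n)) (Cmult l m).
Proof.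
intros [A B] [A' B']; split; simpl.
- apply is_lim_seq_minus'; now apply is_lim_seq_mult'.
- apply is_lim_seq_plus'; now apply is_lim_seq_mult'.
Qed.

Lemma Ccv_RtoC u (l : R) : is_lim_seq u l -> Ccv (fun n => RtoC (u n)) (RtoC l).
Proof. intros H; split; [exact H | apply is_lim_seq_const]. Qed.

Lemma Ccv_Cmod u l : Ccv u l -> is_lim_seq (fun n => Cmod (u n)) (Cmod l).
Proof.
intros [A B]; unfold Cmod.
apply (is_lim_seq_continuous sqrt); [apply continuity_pt_sqrt; nra|].
apply is_lim_seq_plus'; simpl; repeat apply is_lim_seq_mult'; auto; apply is_lim_seq_const.
Qed.

Lemma Ccv_Cmod_le u l (M : nat -> R) (m : R) :
  Ccv u l -> is_lim_seq M m -> (forall n, Cmod (u n) <= M n) -> Cmod l <= m.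
Proof.
intros H HM Hle.
exact (is_lim_seq_le _ _ (Finite (Cmod l)) (Finite m) Hle (Ccv_Cmod _ _ H) HM).
Qed.

Lemma Ccv_0 u : is_lim_seq (fun n => Cmod (u n)) 0 -> Ccv u (RtoC 0).
Proof.
intros H; split; simpl; apply is_lim_seq_abs_0;
  refine (is_lim_seq_le_le (fun _ => 0) _ _ 0 _ (is_lim_seq_const 0) H);
  intros n; (split; [apply Rabs_pos|]).
- eapply Rle_trans; [|apply Rmax_Cmod]; apply Rmax_l.
- eapply Rle_trans; [|apply Rmax_Cmod]; apply Rmax_r.
Qed.

Lemma Cseries_Cmod_le (a : nat -> C) l (M : nat -> R) m :
  is_series a l -> is_series M m -> (forall k, Cmod (a k) <= M k) -> Cmod l <= m.
Proof.
intros H HM Hle; apply Ccv_filterlim in H.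
apply (Ccv_Cmod_le _ _ _ _ H HM); intros n.
induction n as [|n IH]; [now rewrite !sum_O|].
rewrite !sum_Sn; eapply Rle_trans; [apply Cmod_triangle|].
now apply Rplus_le_compat.
Qed.

Lemma Cex_series_le (a : nat -> C) (M : nat -> R) :
  ex_series M -> (forall k, Cmod (a k) <= M k) -> ex_series a.
Proof.
intros HM H.
destruct (ex_series_le (fun k => fst (a k)) M) as [x Hx]; auto.
{ intros k; eapply Rle_trans; [|apply H].
  eapply Rle_trans; [|apply Rmax_Cmod]; apply Rmax_l. }
destruct (ex_series_le (fun k => snd (a k)) M) as [y Hy]; auto.
{ intros k; eapply Rle_trans; [|apply H].
  eapply Rle_trans; [|apply Rmax_Cmod]; apply Rmax_r. }
exists (x, y); now apply Cis_series.
Qed.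

Lemma Rex_series_le (a b : nat -> R) :
  (forall k, Rabs (a k) <= b k) -> ex_series b -> ex_series a.
Proof. exact (@ex_series_le R_AbsRing R_CompleteNormedModule a b). Qed.

(** Tannery's theorem: cut at [K], treat the finite head termwise, and bound the tail by [2 M],
    since [|v| <= M] in the limit. *)
Lemma Series_dominated (q : nat -> nat -> R) (v M : nat -> R) :
  ex_series M -> (forall n k, Rabs (q n k) <= M k) ->
  (forall k, is_lim_seq (fun n => q n k) (v k)) ->
  ex_series v /\ is_lim_seq (fun n => Series (q n)) (Series v).
Proof.
intros HM Hq Hv.
assert (Hvb : forall k, Rabs (v k) <= M k).
{ intros k; assert (HA := is_lim_seq_abs _ _ (Hv k)).
  exact (is_lim_seq_le _ _ (Finite (Rabs (v k))) (Finite (M k)) (fun n => Hq n k) HA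
           (is_lim_seq_const _)). }
assert (Hex : ex_series v) by now apply (Rex_series_le v M).
split; auto.
assert (Hexq : forall n, ex_series (q n)) by (intros n; now apply (Rex_series_le (q n) M)).
apply is_lim_seq_spec; intros eps.
assert (HT : is_lim_seq (fun K => Series M - sum_n M K) 0).
{ replace 0 with (Series M - Series M) by ring.
  apply is_lim_seq_minus'; [apply is_lim_seq_const|]. exact (Series_correct _ HM). }
apply is_lim_seq_spec in HT.
(* The head takes one quarter of [eps] and the tail two, the differences being dominated by
   [2 M]. *)
assert (He4 : 0 < eps / 4) by (destruct eps; simpl; lra).
destruct (HT (mkposreal _ He4)) as [K HK]; specialize (HK K (Nat.le_refl _)); simpl in HK.
rewrite Rminus_0_r in HK.
assert (HS : is_lim_seq (fun n => sum_n (fun k => Rabs (q n k - v k)) K) 0).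
{ clear -Hv; induction K as [|K IH].
  - apply is_lim_seq_ext with (fun n => Rabs (q n O - v O)).
    { intros n; now rewrite sum_O. }
    replace 0 with (Rabs (v O - v O)) by (rewrite Rminus_diag; apply Rabs_R0).
    apply (is_lim_seq_abs _ (Finite (v O - v O))).
    apply is_lim_seq_minus'; [auto|apply is_lim_seq_const].
  - apply is_lim_seq_ext with
      (fun n => sum_n (fun k => Rabs (q n k - v k)) K + Rabs (q n (S K) - v (S K))).
    { intros n; now rewrite sum_Sn. }
    replace 0 with (0 + Rabs (v (S K) - v (S K)))
      by (rewrite Rminus_diag, Rabs_R0; ring).
    apply is_lim_seq_plus'; auto.
    apply (is_lim_seq_abs _ (Finite (v (S K) - v (S K)))).
    apply is_lim_seq_minus'; [auto|apply is_lim_seq_const]. }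
apply is_lim_seq_spec in HS.
destruct (HS (mkposreal _ He4)) as [N HN]; exists N; intros n Hn.
specialize (HN n Hn); simpl in HN; rewrite Rminus_0_r in HN.
rewrite <- Series_minus by auto.
assert (H2M : ex_series (fun k => 2 * M k)).
{ destruct HM as [l Hl]; exists (2 * l); now apply (is_series_scal 2 M l). }
assert (Hd : forall k, Rabs (q n k - v k) <= 2 * M k).
{ intros k; unfold Rminus; eapply Rle_trans; [apply Rabs_triang|].
  rewrite Rabs_Ropp; specialize (Hq n k); specialize (Hvb k); lra. }
assert (Hexd : ex_series (fun k => Rabs (q n k - v k))).
{ apply (Rex_series_le _ (fun k => 2 * M k)); auto.
  intros k; rewrite Rabs_Rabsolu; auto. }
eapply Rle_lt_trans; [apply Series_Rabs; auto|].
rewrite (Series_incr_n _ (S K)) by (auto; lia); simpl pred.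
rewrite <- sum_n_Reals.
assert (Htail : Series (fun k => Rabs (q n (S K + k)%nat - v (S K + k)%nat))
                <= 2 * (Series M - sum_n M K)).
{ assert (HsM : Series M - sum_n M K = Series (fun k => M (S K + k)%nat)).
  { rewrite (Series_incr_n M (S K)) by (auto; lia); simpl pred.
    rewrite <- sum_n_Reals; ring. }
  rewrite HsM, <- Series_scal_l.
  apply Series_le.
  - intros k; split; [apply Rabs_pos|apply Hd].
  - now apply (ex_series_incr_n (fun k => 2 * M k) (S K)). }
apply Rabs_def2 in HK; apply Rabs_def2 in HN; lra.
Qed.

(** * Coefficients of products of linear factors *)

Definition exp_coef (s : R) (k : nat) : R := s ^ k / INR (fact k).

(** Unlike [sum_n], this has [n] terms, in step with [partial_prod] and [prod_coef]. *)
Fixpoint psum (beta : nat -> R) (n : nat) : R :=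
  match n with O => 0 | S n' => psum beta n' + beta n' end.

Lemma INR_fact_S k : INR (fact (S k)) = (INR k + 1) * INR (fact k).
Proof. now rewrite fact_simpl, mult_INR, S_INR. Qed.

Lemma INR_fact_pos k : 0 < INR (fact k).
Proof. apply lt_0_INR, lt_O_fact. Qed.

Lemma exp_coef_pos s k : 0 <= s -> 0 <= exp_coef s k.
Proof.
intros Hs; apply Rmult_le_pos; [now apply pow_le|].
left; apply Rinv_0_lt_compat, INR_fact_pos.
Qed.

Lemma exp_coef_incr s t k : 0 <= s <= t -> exp_coef s k <= exp_coef t k.
Proof.
intros Hs; apply Rmult_le_compat_r; [|now apply pow_incr].
left; apply Rinv_0_lt_compat, INR_fact_pos.
Qed.

Lemma psum_pos beta n : (forall j, 0 <= beta j) -> 0 <= psum beta n.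
Proof. intros H; induction n; simpl; [lra|]; specialize (H n); lra. Qed.

Lemma shift_pos h k : (forall k, 0 <= h k) -> 0 <= shift h k.
Proof. intros H; destruct k; simpl; [lra|auto]. Qed.

Lemma shift_le h g k : (forall k, h k <= g k) -> shift h k <= shift g k.
Proof. intros H; destruct k; simpl; [lra|auto]. Qed.

Lemma mul_linear_pos w h k : 0 <= w -> (forall k, 0 <= h k) -> 0 <= mul_linear w h k.
Proof.
intros Hw Hh; unfold mul_linear; assert (H := shift_pos h k Hh); specialize (Hh k); nra.
Qed.

Lemma mul_linear_le w h g k : 0 <= w -> (forall k, h k <= g k) -> mul_linear w h k <= mul_linear w g k.
Proof.
intros Hw Hh; unfold mul_linear; assert (H := shift_le h g k Hh); specialize (Hh k); nra.
Qed.

Lemma one_coef_pos k : 0 <= one_coef k.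
Proof. destruct k; simpl; lra. Qed.

Lemma prod_coef_pos beta n k : (forall j, 0 <= beta j) -> 0 <= prod_coef beta n k.
Proof.
intros H; revert k; induction n as [|n IH]; intros k; [apply one_coef_pos|].
now apply mul_linear_pos.
Qed.

Lemma prod_coef_0 beta n : prod_coef beta n 0 = 1.
Proof. induction n; simpl; auto; unfold mul_linear; simpl; rewrite IHn; ring. Qed.

Lemma prod_coef_1 beta n : prod_coef beta n 1 = psum beta n.
Proof.
induction n as [|n IH]; simpl; auto; unfold mul_linear; simpl; rewrite IH, prod_coef_0; ring.
Qed.

Lemma pow_bernoulli s w k : 0 <= s -> 0 <= w ->
  s ^ S k + (INR k + 1) * w * s ^ k <= (s + w) ^ S k.
Proof.
intros Hs Hw; induction k as [|k IH]; [simpl; lra|].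
assert (H := pow_le s k Hs); assert (H' := pos_INR k).
rewrite S_INR.
apply Rle_trans with ((s + w) * (s ^ S k + (INR k + 1) * w * s ^ k)).
- simpl.
  assert (0 <= (INR k + 1) * (w * w) * s ^ k)
    by (repeat apply Rmult_le_pos; lra).
  nra.
- change ((s + w) ^ S (S k)) with ((s + w) * (s + w) ^ S k).
  apply Rmult_le_compat_l; lra.
Qed.

(** The Bernoulli inequality [pow_bernoulli] divided by a factorial; for functions, trading
    [1 + w z] for [e^(w z)] only raises coefficients. *)
Lemma mul_linear_exp_coef_le s w k : 0 <= s -> 0 <= w -> mul_linear w (exp_coef s) k <= exp_coef (s + w) k.
Proof.
intros Hs Hw; destruct k as [|k]; unfold mul_linear, shift, exp_coef; [simpl; lra|].
rewrite INR_fact_S; assert (H := INR_fact_pos k); assert (H' := pos_INR k).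
replace (s ^ S k / ((INR k + 1) * INR (fact k)) + w * (s ^ k / INR (fact k)))
  with ((s ^ S k + (INR k + 1) * w * s ^ k) / ((INR k + 1) * INR (fact k)))
  by (field; lra).
apply Rmult_le_compat_r; [|now apply pow_bernoulli].
left; apply Rinv_0_lt_compat; nra.
Qed.

(** Trading all factors for exponentials gives a single majorant for all products with the same
    bound on the sum of [beta]; the limits of products below rest on it. *)
Lemma prod_coef_le_exp_coef beta n k : (forall j, 0 <= beta j) -> prod_coef beta n k <= exp_coef (psum beta n) k.
Proof.
intros H; revert k; induction n as [|n IH]; intros k.
- destruct k; unfold exp_coef; simpl; [lra|]; rewrite Rmult_0_l; unfold Rdiv; lra.
- simpl; eapply Rle_trans; [apply mul_linear_le; [auto|exact IH]|].
  apply mul_linear_exp_coef_le; auto; now apply psum_pos.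
Qed.

(** Second-order remainder of a power. Taylor's formula would give half of the right-hand side; the
    factor is of no importance here. *)
Lemma pow_taylor2 s w m : 0 <= s -> 0 <= w ->
  (s + w) ^ S (S m) - s ^ S (S m) - (INR m + 2) * w * s ^ S m
    <= (INR m + 2) * (INR m + 1) * w ^ 2 * (s + w) ^ m.
Proof.
intros Hs Hw; induction m as [|m IH]; [simpl; nra|].
assert (Hm := pos_INR m).
assert (H : s ^ S m <= (s + w) ^ S m) by (apply pow_incr; lra).
assert (H0 : 0 <= s ^ S m) by now apply pow_le.
set (A := (s + w) ^ S (S m)) in *; set (B := s ^ S m) in *.
rewrite S_INR; change (s ^ S (S (S m))) with (s * (s * B)).
change (s ^ S (S m)) with (s * B) in IH |- *.
change ((s + w) ^ S (S (S m))) with ((s + w) * A).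
apply Rle_trans with ((s + w) * (A - s * B - (INR m + 2) * w * B) + (INR m + 2) * w ^ 2 * B).
{ right; ring. }
apply Rle_trans with ((s + w) * ((INR m + 2) * (INR m + 1) * w ^ 2 * (s + w) ^ m)
  + (INR m + 2) * w ^ 2 * (s + w) ^ S m).
- apply Rplus_le_compat; [apply Rmult_le_compat_l; lra|].
  apply Rmult_le_compat_l; [|lra]; apply Rmult_le_pos; [lra|apply pow2_ge_0].
- assert (0 <= w ^ 2 * (s + w) ^ S m)
    by (apply Rmult_le_pos; [apply pow2_ge_0|lra]).
  replace ((s + w) * ((INR m + 2) * (INR m + 1) * w ^ 2 * (s + w) ^ m)
    + (INR m + 2) * w ^ 2 * (s + w) ^ S m)
    with ((INR m + 2) * (INR m + 2) * (w ^ 2 * (s + w) ^ S m)) by (simpl; ring).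
  replace ((INR m + 1 + 2) * (INR m + 1 + 1) * w ^ 2 * (s + w) ^ S m)
    with ((INR m + 3) * (INR m + 2) * (w ^ 2 * (s + w) ^ S m)) by ring.
  apply Rmult_le_compat_r; auto; nra.
Qed.

Lemma exp_coef_taylor2 s w k : 0 <= s -> 0 <= w ->
  exp_coef (s + w) k - mul_linear w (exp_coef s) k <= w ^ 2 * shift (shift (exp_coef (s + w))) k.
Proof.
intros Hs Hw; destruct k as [|[|k]]; [unfold mul_linear, exp_coef; simpl; lra..|].
unfold mul_linear; simpl shift; unfold exp_coef; rewrite !INR_fact_S, S_INR.
assert (H := INR_fact_pos k); assert (H' := pos_INR k).
replace ((s + w) ^ S (S k) / ((INR k + 1 + 1) * ((INR k + 1) * INR (fact k))) -
  (s ^ S (S k) / ((INR k + 1 + 1) * ((INR k + 1) * INR (fact k))) +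
   w * (s ^ S k / ((INR k + 1) * INR (fact k)))))
 with (((s + w) ^ S (S k) - s ^ S (S k) - (INR k + 2) * w * s ^ S k) /
       ((INR k + 2) * (INR k + 1) * INR (fact k))) by (field; lra).
replace (w ^ 2 * ((s + w) ^ k / INR (fact k)))
  with ((INR k + 2) * (INR k + 1) * w ^ 2 * (s + w) ^ k /
        ((INR k + 2) * (INR k + 1) * INR (fact k))) by (field; lra).
apply Rmult_le_compat_r; [|now apply pow_taylor2].
left; apply Rinv_0_lt_compat; repeat apply Rmult_lt_0_compat; lra.
Qed.

(** Telescoping: trading one factor costs [w^2 z^2] times the exponential ([exp_coef_taylor2]),
    hence the sum of squares. It is small when all [beta j] are small, even if their sum is not. The
    double [shift] is the factor [z^2]. *)
Lemma exp_coef_sub_prod_coef_le beta n k : (forall j, 0 <= beta j) ->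
  exp_coef (psum beta n) k - prod_coef beta n k
    <= psum (fun j => beta j ^ 2) n * shift (shift (exp_coef (psum beta n))) k.
Proof.
intros Hb; revert k; induction n as [|n IH]; intros k.
- simpl; rewrite Rmult_0_l; unfold exp_coef; destruct k; simpl; [lra|].
  rewrite Rmult_0_l; unfold Rdiv; lra.
- change (psum (fun j => beta j ^ 2) (S n)) with (psum (fun j => beta j ^ 2) n + beta n ^ 2).
  change (psum beta (S n)) with (psum beta n + beta n); simpl prod_coef.
  set (s := psum beta n) in *; set (w := beta n); set (Q := psum (fun j => beta j ^ 2) n) in *.
  assert (Hs : 0 <= s) by now apply psum_pos.
  assert (Hw : 0 <= w) by apply Hb.
  assert (HQ : 0 <= Q) by (apply psum_pos; intros j; apply pow2_ge_0).
  assert (H1 := exp_coef_taylor2 s w k Hs Hw).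
  (* The error already made is multiplied by the new factor [1 + w z]; [H3] absorbs that factor into
     the exponential. *)
  assert (H2 : mul_linear w (exp_coef s) k - mul_linear w (prod_coef beta n) k <=
               Q * shift (shift (mul_linear w (exp_coef s))) k).
  { assert (A := IH k); destruct k as [|k]; unfold mul_linear; simpl in *.
    - lra.
    - assert (A' := IH k); destruct k as [|k]; simpl in *; nra. }
  assert (H3 : shift (shift (mul_linear w (exp_coef s))) k <= shift (shift (exp_coef (s + w))) k).
  { apply shift_le; intros k0; apply shift_le; intros k1; now apply mul_linear_exp_coef_le. }
  assert (H4 := Rmult_le_compat_l Q _ _ HQ H3).
  rewrite Rmult_plus_distr_r; lra.
Qed.

Lemma Ris_series_ext (a b : nat -> R) (l : R) :
  (forall k, a k = b k) -> is_series a l -> is_series b l.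
Proof. exact (@is_series_ext R_AbsRing R_NormedModule a b l). Qed.

Lemma is_series_exp_coef s r : is_series (fun k => exp_coef s k * r ^ k) (exp (s * r)).
Proof.
apply Ris_series_ext with (fun k => / INR (fact k) * (s * r) ^ k).
{ intros k; unfold exp_coef; rewrite Rpow_mult_distr; unfold Rdiv; ring. }
apply is_pseries_R, is_exp_Reals.
Qed.

Lemma is_series_shift (h : nat -> R) (r l : R) :
  is_series (fun k => h k * r ^ k) l -> is_series (fun k => shift h k * r ^ k) (r * l).
Proof.
intros H; apply is_series_decr_1.
match goal with |- is_series _ ?x => replace x with (r * l) end.
2:{ change (r * l = r * l + - (0 * 1)); ring. }
apply Ris_series_ext with (fun k => r * (h k * r ^ k)); [intros k; simpl; ring|].
now apply (is_series_scal r _ l).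
Qed.

Lemma Cis_series_shift (h : nat -> R) (z l : C) :
  is_series (fun k => Cmult (RtoC (h k)) (Cpow z k)) l ->
  is_series (fun k => Cmult (RtoC (shift h k)) (Cpow z k)) (Cmult z l).
Proof.
intros H; apply is_series_decr_1.
match goal with |- is_series _ ?x => replace x with (Cmult z l) end.
2:{ change (Cmult z l = Cplus (Cmult z l) (Copp (Cmult (RtoC 0) (RtoC 1)))); ring. }
apply is_series_ext with (fun k => scal z (Cmult (RtoC (h k)) (Cpow z k))).
{ intros k; simpl; change (Cmult z (Cmult (RtoC (h k)) (Cpow z k)) =
    Cmult (RtoC (h k)) (Cmult z (Cpow z k))); ring. }
exact (is_series_scal z _ l H).
Qed.

Lemma prod_coef_is_series beta n (z : C) :
  is_series (fun k => Cmult (RtoC (prod_coef beta n k)) (Cpow z k)) (partial_prod beta z n).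
Proof.
induction n as [|n IH].
- apply is_series_decr_1; simpl.
  match goal with |- is_series _ ?x => replace x with (RtoC 0) end.
  2:{ change (RtoC 0 = Cplus (RtoC 1) (Copp (Cmult (RtoC 1) (RtoC 1)))); ring. }
  assert (H0 : is_series (fun _ : nat => 0) 0).
  { apply filterlim_ext with (fun _ => 0); [|apply filterlim_const].
    intros k; rewrite sum_n_const; symmetry; apply Rmult_0_r. }
  apply Cis_series; split; eapply Ris_series_ext; try exact H0; intros k; simpl; ring.
- simpl.
  apply is_series_ext with
    (fun k => plus (Cmult (RtoC (prod_coef beta n k)) (Cpow z k))
       (scal (RtoC (beta n)) (Cmult (RtoC (shift (prod_coef beta n) k)) (Cpow z k)))).
  { intros k; unfold mul_linear; rewrite RtoC_plus, RtoC_mult.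
    change (Cplus (Cmult (RtoC (prod_coef beta n k)) (Cpow z k))
       (Cmult (RtoC (beta n)) (Cmult (RtoC (shift (prod_coef beta n) k)) (Cpow z k))) =
       Cmult (Cplus (RtoC (prod_coef beta n k)) (Cmult (RtoC (beta n)) (RtoC (shift (prod_coef beta n) k)))) (Cpow z k)).
    ring. }
  match goal with |- is_series _ ?x => replace x with
    (plus (partial_prod beta z n) (scal (RtoC (beta n)) (Cmult z (partial_prod beta z n)))) end.
  2:{ change (Cplus (partial_prod beta z n) (Cmult (RtoC (beta n)) (Cmult z (partial_prod beta z n)))
     = Cmult (partial_prod beta z n) (Cplus (RtoC 1) (Cmult (RtoC (beta n)) z))); ring. }
  apply (is_series_plus _ _ _ _ IH).
  apply (is_series_scal (RtoC (beta n)) _ _ (Cis_series_shift _ _ _ IH)).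
Qed.

Lemma Cmod_Cpow (z : C) k : Cmod (Cpow z k) = Cmod z ^ k.
Proof.
induction k; simpl; [apply Cmod_1|]; now rewrite Cmod_mult, IHk.
Qed.

Lemma Cmod_RtoC_pow (x : R) (z : C) k :
  Cmod (Cmult (RtoC x) (Cpow z k)) = Rabs x * Cmod z ^ k.
Proof. now rewrite Cmod_mult, Cmod_R, Cmod_Cpow. Qed.

Lemma exp_coef_dominated_ex (h : nat -> R) s (z : C) :
  (forall k, Rabs (h k) <= exp_coef s k) ->
  ex_series (fun k => Cmult (RtoC (h k)) (Cpow z k)).
Proof.
intros H; apply Cex_series_le with (fun k => exp_coef s k * Cmod z ^ k).
- eexists; apply is_series_exp_coef.
- intros k; rewrite Cmod_RtoC_pow; apply Rmult_le_compat_r; auto.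
  apply pow_le, Cmod_ge_0.
Qed.

(** [Series_dominated] for real and imaginary parts at each [z], with the terms of [e^(s |z|)] as
    majorant: convergence of coefficients becomes pointwise convergence of functions. *)
Lemma exp_coef_dominated_cv (q : nat -> nat -> R) (v : nat -> R) s (z : C) (Q : nat -> C) :
  (forall n k, Rabs (q n k) <= exp_coef s k) ->
  (forall k, is_lim_seq (fun n => q n k) (v k)) ->
  (forall n, is_series (fun k => Cmult (RtoC (q n k)) (Cpow z k)) (Q n)) ->
  exists V : C, is_series (fun k => Cmult (RtoC (v k)) (Cpow z k)) V /\ Ccv Q V.
Proof.
intros Hq Hv HQ.
assert (HM : ex_series (fun k => exp_coef s k * Cmod z ^ k)) by (eexists; apply is_series_exp_coef).
assert (HC : forall n k, Cmod (Cmult (RtoC (q n k)) (Cpow z k)) <= exp_coef s k * Cmod z ^ k).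
{ intros n k; rewrite Cmod_RtoC_pow; apply Rmult_le_compat_r; auto.
  apply pow_le, Cmod_ge_0. }
assert (Hk : forall k, Ccv (fun n => Cmult (RtoC (q n k)) (Cpow z k))
                        (Cmult (RtoC (v k)) (Cpow z k))).
{ intros k; apply Ccv_mult; [now apply Ccv_RtoC|apply Ccv_const]. }
destruct (Series_dominated (fun n k => fst (Cmult (RtoC (q n k)) (Cpow z k)))
   (fun k => fst (Cmult (RtoC (v k)) (Cpow z k))) _ HM) as [E1 L1].
{ intros n k; eapply Rle_trans; [|apply HC].
  eapply Rle_trans; [|apply Rmax_Cmod]; apply Rmax_l. }
{ intros k; apply Hk. }
destruct (Series_dominated (fun n k => snd (Cmult (RtoC (q n k)) (Cpow z k)))
   (fun k => snd (Cmult (RtoC (v k)) (Cpow z k))) _ HM) as [E2 L2].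
{ intros n k; eapply Rle_trans; [|apply HC].
  eapply Rle_trans; [|apply Rmax_Cmod]; apply Rmax_r. }
{ intros k; apply Hk. }
exists (CSeries (fun k => Cmult (RtoC (v k)) (Cpow z k))); split.
- apply Cis_series; split; now apply Series_correct.
- split.
  + eapply is_lim_seq_ext; [|exact L1]; intros n.
    apply is_series_unique; now apply (Cis_series _ (Q n)).
  + eapply is_lim_seq_ext; [|exact L2]; intros n.
    apply is_series_unique; now apply (Cis_series _ (Q n)).
Qed.

(** The coefficient estimate summed at [|z|], where [z^2 e^(s z)] becomes [|z|^2 e^(s |z|)]. *)
Lemma partial_prod_exp beta n (z E : C) : (forall j, 0 <= beta j) ->
  is_series (fun k => Cmult (RtoC (exp_coef (psum beta n) k)) (Cpow z k)) E ->
  Cmod (Cminus (partial_prod beta z n) E)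
    <= psum (fun j => beta j ^ 2) n * (Cmod z ^ 2 * exp (psum beta n * Cmod z)).
Proof.
intros Hb HE.
set (Q := psum (fun j => beta j ^ 2) n); set (s := psum beta n) in *; set (r := Cmod z).
apply (Cseries_Cmod_le
  (fun k => Cminus (Cmult (RtoC (prod_coef beta n k)) (Cpow z k)) (Cmult (RtoC (exp_coef s k)) (Cpow z k)))
  _ (fun k => Q * (shift (shift (exp_coef s)) k * r ^ k))).
- exact (is_series_minus _ _ _ _ (prod_coef_is_series beta n z) HE).
- apply (is_series_scal Q (fun k => shift (shift (exp_coef s)) k * r ^ k) (r ^ 2 * exp (s * r))).
  replace (r ^ 2 * exp (s * r)) with (r * (r * exp (s * r))) by (simpl; ring).
  now repeat apply is_series_shift; apply is_series_exp_coef.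
- intros k.
  replace (Cminus (Cmult (RtoC (prod_coef beta n k)) (Cpow z k)) (Cmult (RtoC (exp_coef s k)) (Cpow z k)))
    with (Cmult (RtoC (prod_coef beta n k - exp_coef s k)) (Cpow z k)).
  2:{ unfold Rminus; rewrite RtoC_plus, RtoC_opp; ring. }
  rewrite Cmod_RtoC_pow, <- Rmult_assoc; apply Rmult_le_compat_r.
  { apply pow_le, Cmod_ge_0. }
  rewrite Rabs_minus_sym, Rabs_right.
  + now apply exp_coef_sub_prod_coef_le.
  + assert (H := prod_coef_le_exp_coef beta n k Hb); fold s in H; lra.
Qed.

(** * Limits of polynomials with nonpositive zeros *)

Lemma prod_coef_incr beta n k : (forall j, 0 <= beta j) -> prod_coef beta n k <= prod_coef beta (S n) k.
Proof.
intros Hb; simpl; unfold mul_linear.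
assert (H := shift_pos (prod_coef beta n) k (fun k => prod_coef_pos beta n k Hb)).
specialize (Hb n); nra.
Qed.

(** A further factor with [beta n >= 0] can only raise coefficients, so they converge monotonically
    below those of [e^(s z)]; this makes the infinite product a power series. *)
Lemma prod_limit beta s : (forall j, 0 <= beta j) -> (forall n, psum beta n <= s) ->
  exists e : nat -> R,
    (forall k, is_lim_seq (fun n => prod_coef beta n k) (e k)) /\
    (forall n k, prod_coef beta n k <= e k) /\ (forall k, e k <= exp_coef s k) /\
    forall z : C, exists P : C,
      is_series (fun k => Cmult (RtoC (e k)) (Cpow z k)) P /\ Ccv (partial_prod beta z) P.
Proof.
intros Hb Hs.
assert (Hle : forall n k, prod_coef beta n k <= exp_coef s k).
{ intros n k; eapply Rle_trans; [now apply prod_coef_le_exp_coef|].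
  apply exp_coef_incr; split; auto; now apply psum_pos. }
assert (Hex : forall k, ex_finite_lim_seq (fun n => prod_coef beta n k)).
{ intros k; apply ex_finite_lim_seq_incr with (exp_coef s k); auto.
  intros n; now apply prod_coef_incr. }
exists (fun k => real (Lim_seq (fun n => prod_coef beta n k))).
assert (Hlim : forall k, is_lim_seq (fun n => prod_coef beta n k)
                   (real (Lim_seq (fun n => prod_coef beta n k)))).
{ intros k; now apply Lim_seq_correct'. }
split; [exact Hlim|split; [|split]].
- intros n k; apply (is_lim_seq_incr_compare _ _ (Hlim k)); intros m; now apply prod_coef_incr.
- intros k.
  exact (is_lim_seq_le _ _ (Finite _) (Finite (exp_coef s k)) (fun n => Hle n k) (Hlim k)
           (is_lim_seq_const _)).
- intros z.
  destruct (exp_coef_dominated_cv (prod_coef beta) (fun k => real (Lim_seq (fun n => prod_coef beta n k)))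
    s z (partial_prod beta z)) as [P [HP1 HP2]].
  + intros n k; rewrite Rabs_right; auto; apply Rle_ge; now apply prod_coef_pos.
  + exact Hlim.
  + intros n; apply prod_coef_is_series.
  + now exists P.
Qed.

(** * Diagonal extraction *)

Section ClusterPoints.

Variable B : nat -> nat -> R.

(** The rows of [B], truncated to [J] entries, cluster at the first [J] entries of [beta].
    Quantifying over [N] and [eps] spares a nested family of subsequences. *)
Definition cluster (beta : nat -> R) (J : nat) : Prop :=
  forall (N : nat) (eps : R), 0 < eps ->
    exists n, (N <= n)%nat /\ forall j, (j < J)%nat -> Rabs (B n j - beta j) < eps.

Definition update (beta : nat -> R) (J : nat) (x : R) (j : nat) : R :=
  if Nat.eqb j J then x else beta j.

(** Choose rows [f m] that match the first [J] entries up to [1/(m+1)], then apply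
    Bolzano-Weierstrass to entry [J] along [f]. *)
Lemma cluster_extend s beta J : (forall n j, 0 <= B n j <= s) ->
  cluster beta J -> exists x, cluster (update beta J x) (S J).
Proof.
intros HB Hc.
assert (Hm : forall m : nat, exists n, (m <= n)%nat /\
          forall j, (j < J)%nat -> Rabs (B n j - beta j) < / (INR m + 1)).
{ intros m; apply Hc, Rinv_0_lt_compat; assert (H := pos_INR m); lra. }
set (f := fun m => proj1_sig (constructive_indefinite_description _ (Hm m))).
assert (Hf : forall m, (m <= f m)%nat /\
          forall j, (j < J)%nat -> Rabs (B (f m) j - beta j) < / (INR m + 1)).
{ intros m; unfold f; now destruct (constructive_indefinite_description _ (Hm m)). }
destruct (Bolzano_Weierstrass (fun m => B (f m) J) (fun c => 0 <= c <= s)) as [x Hx].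
{ apply compact_P3. }
{ intros m; apply HB. }
exists x; intros N eps He.
destruct (archimed_cor1 eps He) as [N1 [HN1 HN1']].
destruct (Hx (disc x (mkposreal _ He)) (max N N1)) as [p [Hp1 Hp2]].
{ now exists (mkposreal _ He). }
destruct (Hf p) as [Hf1 Hf2]; exists (f p); split; [lia|].
intros j Hj; unfold update; destruct (Nat.eqb_spec j J) as [->|Hne].
- exact Hp2.
- eapply Rlt_le_trans; [apply Hf2; lia|].
  apply Rle_trans with (/ INR N1); [|lra].
  apply Rinv_le_contravar; [apply lt_0_INR; lia|].
  assert (H : INR N1 <= INR p) by (apply le_INR; lia); lra.
Qed.

(** Entry [J] is picked by [epsilon] among those that [cluster_extend] provides and is never altered
    later, so the diagonal [build (S j) j] agrees with every stage. *)
Fixpoint build (J : nat) : nat -> R :=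
  match J with
  | O => fun _ => 0
  | S J' => update (build J') J'
              (epsilon (inhabits 0) (fun x => cluster (update (build J') J' x) (S J')))
  end.

(** Row [phi m] matches the first [m] entries up to [1/(m+1)]. As [phi m >= m], limits pass to this
    subsequence without [phi] being increasing. *)
Lemma diagonal_extraction s : (forall n j, 0 <= B n j <= s) ->
  exists (phi : nat -> nat) (beta : nat -> R),
    filterlim phi eventually eventually /\
    forall j, is_lim_seq (fun n => B (phi n) j) (beta j).
Proof.
intros HB.
assert (Hb : forall J, cluster (build J) J).
{ induction J as [|J IH].
  - intros N eps _; exists N; split; [lia|]; intros j Hj; lia.
  - simpl; apply epsilon_spec; now apply cluster_extend with s. }
set (beta := fun j => build (S j) j).
assert (Hst : forall J j, (j < J)%nat -> build J j = beta j).
{ induction J as [|J IH]; intros j Hj; [lia|].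
  destruct (Nat.eq_dec j J) as [->|Hne]; [reflexivity|].
  rewrite <- IH by lia; simpl; unfold update.
  destruct (Nat.eqb_spec j J); [contradiction|reflexivity]. }
assert (Hm : forall m : nat, exists n, (m <= n)%nat /\
          forall j, (j < m)%nat -> Rabs (B n j - beta j) < / (INR m + 1)).
{ intros m; destruct (Hb m m (/ (INR m + 1))) as [n [Hn1 Hn2]].
  { apply Rinv_0_lt_compat; assert (H := pos_INR m); lra. }
  exists n; split; auto; intros j Hj; rewrite <- (Hst m) by auto; auto. }
set (phi := fun m => proj1_sig (constructive_indefinite_description _ (Hm m))).
assert (Hp : forall m, (m <= phi m)%nat /\
          forall j, (j < m)%nat -> Rabs (B (phi m) j - beta j) < / (INR m + 1)).
{ intros m; unfold phi; now destruct (constructive_indefinite_description _ (Hm m)). }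
exists phi, beta; split.
- intros P [N HN]; exists N; intros n Hn; apply HN.
  destruct (Hp n); lia.
- intros j; apply is_lim_seq_spec; intros eps.
  destruct (archimed_cor1 eps (cond_pos eps)) as [N1 [HN1 HN1']].
  exists (max (S j) N1); intros n Hn; destruct (Hp n) as [_ H].
  eapply Rlt_le_trans; [apply H; lia|].
  apply Rle_trans with (/ INR N1); [|lra].
  apply Rinv_le_contravar; [apply lt_0_INR; lia|].
  assert (H' : INR N1 <= INR n) by (apply le_INR; lia); lra.
Qed.

End ClusterPoints.

(** * Tails of products and limits of normalized products *)

Lemma psum_add beta J m :
  psum beta (J + m) = psum beta J + psum (fun j => beta (J + j)%nat) m.
Proof.
induction m as [|m IH]; simpl; [rewrite Nat.add_0_r; ring|].
rewrite Nat.add_succ_r; simpl; rewrite IH; ring.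
Qed.

Lemma partial_prod_add beta z J m :
  partial_prod beta z (J + m) =
  Cmult (partial_prod beta z J) (partial_prod (fun j => beta (J + j)%nat) z m).
Proof.
induction m as [|m IH]; simpl; [rewrite Nat.add_0_r; ring|].
rewrite Nat.add_succ_r; simpl; rewrite IH; ring.
Qed.

Lemma partial_prod_zero_tail beta z N m : (forall j, (N <= j)%nat -> beta j = 0) ->
  partial_prod beta z (N + m) = partial_prod beta z N.
Proof.
intros H; induction m as [|m IH]; [now rewrite Nat.add_0_r|].
rewrite Nat.add_succ_r; simpl; rewrite IH, H by lia; ring.
Qed.

Lemma psum_zero_tail beta N m : (forall j, (N <= j)%nat -> beta j = 0) ->
  psum beta (N + m) = psum beta N.
Proof.
intros H; induction m as [|m IH]; [now rewrite Nat.add_0_r|].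
rewrite Nat.add_succ_r; simpl; rewrite IH, H by lia; ring.
Qed.

Lemma psum_antitone beta n : (forall j, beta (S j) <= beta j) ->
  INR n * beta n <= psum beta n.
Proof.
intros H; induction n as [|n IH]; [simpl; lra|].
rewrite S_INR; simpl psum; specialize (H n); assert (Hn := pos_INR n).
assert (INR n * beta (S n) <= INR n * beta n) by now apply Rmult_le_compat_l.
lra.
Qed.

Lemma psum_sq_le beta n M : (forall j, 0 <= beta j <= M) ->
  psum (fun j => beta j ^ 2) n <= M * psum beta n.
Proof.
intros H; induction n as [|n IH]; [simpl; lra|].
change (psum (fun j => beta j ^ 2) n + beta n ^ 2 <= M * (psum beta n + beta n)).
specialize (H n); nra.
Qed.

Definition Cexp_series (s : R) (z : C) : C := CSeries (fun k => Cmult (RtoC (exp_coef s k)) (Cpow z k)).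

Lemma Cexp_series_is_series s z : 0 <= s ->
  is_series (fun k => Cmult (RtoC (exp_coef s k)) (Cpow z k)) (Cexp_series s z).
Proof.
intros Hs; destruct (exp_coef_dominated_ex (exp_coef s) s z) as [l Hl].
{ intros k; rewrite Rabs_right; [lra|]; apply Rle_ge; now apply exp_coef_pos. }
apply Cis_series in Hl; destruct Hl as [H1 H2].
apply Cis_series; split; apply Series_correct; eexists; eassumption.
Qed.

Lemma Cexp_series_cv (t : nat -> R) s (l : R) z : (forall n, 0 <= t n <= s) -> is_lim_seq t l ->
  0 <= l -> Ccv (fun n => Cexp_series (t n) z) (Cexp_series l z).
Proof.
intros Ht Hl Hl0.
destruct (exp_coef_dominated_cv (fun n k => exp_coef (t n) k) (exp_coef l) s z (fun n => Cexp_series (t n) z))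
  as [V [HV1 HV2]].
- intros n k; rewrite Rabs_right; [now apply exp_coef_incr|].
  apply Rle_ge, exp_coef_pos, Ht.
- intros k; unfold exp_coef, Rdiv; apply is_lim_seq_mult'; [|apply is_lim_seq_const].
  induction k as [|k IH]; simpl; [apply is_lim_seq_const|].
  now apply is_lim_seq_mult'.
- intros n; apply Cexp_series_is_series, Ht.
- now rewrite (Cis_series_unique _ _ _ (Cexp_series_is_series l z Hl0) HV1).
Qed.

Lemma partial_prod_Cmod beta z n : (forall j, 0 <= beta j) ->
  Cmod (partial_prod beta z n) <= exp (psum beta n * Cmod z).
Proof.
intros Hb; apply (Cseries_Cmod_le _ _ (fun k => exp_coef (psum beta n) k * Cmod z ^ k) _
  (prod_coef_is_series beta n z)).
- apply is_series_exp_coef.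
- intros k; rewrite Cmod_RtoC_pow; apply Rmult_le_compat_r; [apply pow_le, Cmod_ge_0|].
  rewrite Rabs_right; [now apply prod_coef_le_exp_coef|]; apply Rle_ge; now apply prod_coef_pos.
Qed.

Lemma partial_prod_cv (B : nat -> nat -> R) (beta : nat -> R) z J :
  (forall j, is_lim_seq (fun n => B n j) (beta j)) ->
  Ccv (fun n => partial_prod (B n) z J) (partial_prod beta z J).
Proof.
intros H; induction J as [|J IH]; simpl; [apply Ccv_const|].
apply Ccv_mult; auto; apply Ccv_plus; [apply Ccv_const|].
apply Ccv_mult; [apply (Ccv_RtoC (fun n => B n J)), H|apply Ccv_const].
Qed.

Lemma psum_cv (B : nat -> nat -> R) (beta : nat -> R) J :
  (forall j, is_lim_seq (fun n => B n j) (beta j)) ->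
  is_lim_seq (fun n => psum (B n) J) (psum beta J).
Proof.
intros H; induction J as [|J IH]; simpl; [apply is_lim_seq_const|].
now apply is_lim_seq_plus'.
Qed.

Lemma psum_sum_n beta n : psum beta (S n) = sum_n beta n.
Proof.
induction n as [|n IH]; [simpl; rewrite sum_O; ring|].
rewrite sum_Sn; change (psum beta (S (S n))) with (psum beta (S n) + beta (S n)).
now rewrite IH.
Qed.

Lemma psum_ex_series beta s : (forall j, 0 <= beta j) -> (forall n, psum beta n <= s) ->
  ex_series beta /\ is_lim_seq (psum beta) (Series beta).
Proof.
intros Hb Hs.
destruct (ex_finite_lim_seq_incr (sum_n beta) s) as [l Hl].
{ intros n; rewrite sum_Sn; change (sum_n beta n <= sum_n beta n + beta (S n)).
  specialize (Hb (S n)); lra. }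
{ intros n; rewrite <- psum_sum_n; apply Hs. }
assert (He : ex_series beta) by now exists l.
split; auto.
apply is_lim_seq_incr_1.
apply is_lim_seq_ext with (sum_n beta); [intros n; now rewrite psum_sum_n|].
now apply (Series_correct beta).
Qed.

(** By monotonicity the entries from [J] on are at most [B J <= s/(J+1)], so their squares sum to at
    most [s^2/(J+1)] and the tail is nearly an exponential. The bound depends on [B] only through
    [s], hence survives a limit along a sequence of products. *)
Lemma head_exp_tail_le (B : nat -> R) N z s J :
  (forall j, 0 <= B (S j) <= B j) -> (forall j, 0 <= B j) ->
  (forall j, (N <= j)%nat -> B j = 0) -> psum B N <= s ->
  0 <= psum B N - psum B J <= s /\
  Cmod (Cminus (partial_prod B z N)
          (Cmult (partial_prod B z J) (Cexp_series (psum B N - psum B J) z)))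
    <= exp (s * Cmod z) * (s * s * (Cmod z ^ 2 * exp (s * Cmod z))) / (INR J + 1).
Proof.
intros HB HB0 HN Hs.
set (B' := fun j => B (J + j)%nat).
assert (HB' : forall j, 0 <= B' j <= B J).
{ induction j as [|j IH]; unfold B' in *.
  - rewrite Nat.add_0_r; split; auto; lra.
  - rewrite Nat.add_succ_r; destruct (HB (J + j)%nat); lra. }
assert (HB0' : forall j, 0 <= B' j) by (intros j; apply HB').
(* Replacing [N] by [N + J], harmless since [B] vanishes from [N] on, avoids comparing [J] with
   [N]. *)
assert (E1 : psum B N = psum B J + psum B' N).
{ rewrite <- (psum_zero_tail B N J HN), Nat.add_comm; apply psum_add. }
assert (E2 : partial_prod B z N = Cmult (partial_prod B z J) (partial_prod B' z N)).
{ rewrite <- (partial_prod_zero_tail B z N J HN), Nat.add_comm; apply partial_prod_add. }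
assert (P1 : 0 <= psum B J) by now apply psum_pos.
assert (P2 : 0 <= psum B' N) by now apply psum_pos.
replace (psum B N - psum B J) with (psum B' N) by lra.
split; [lra|].
rewrite E2.
replace (Cminus (Cmult (partial_prod B z J) (partial_prod B' z N))
                (Cmult (partial_prod B z J) (Cexp_series (psum B' N) z)))
  with (Cmult (partial_prod B z J) (Cminus (partial_prod B' z N) (Cexp_series (psum B' N) z)))
  by ring.
assert (Hz := Cmod_ge_0 z).
assert (Hexp : forall t, t <= s -> exp (t * Cmod z) <= exp (s * Cmod z)).
{ intros t Ht; assert (H : t * Cmod z <= s * Cmod z) by now apply Rmult_le_compat_r.
  destruct H as [H| ->]; [left; now apply exp_increasing|lra]. }
rewrite Cmod_mult; unfold Rdiv; rewrite Rmult_assoc; apply Rmult_le_compat.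
- apply Cmod_ge_0.
- apply Cmod_ge_0.
- eapply Rle_trans; [now apply partial_prod_Cmod|]; apply Hexp; lra.
- eapply Rle_trans; [apply (partial_prod_exp B' N z _ HB0'); now apply Cexp_series_is_series|].
  assert (HJ := pos_INR J).
  (* [psum_antitone] accounts for [J] copies of [B J]; the entry [B J] itself is the last of the
     [J + 1]. *)
  assert (HBJ : B J <= s * / (INR J + 1)).
  { assert (H := psum_antitone B J (fun j => proj2 (HB j))).
    assert (H2 : psum B (S J) <= s).
    { assert (H3 : psum B (S J) <= psum B N).
      { assert (H4 := psum_zero_tail B N (S J) HN).
        rewrite Nat.add_comm, psum_add in H4; rewrite <- H4.
        assert (0 <= psum (fun j => B (S J + j)%nat) N) by (apply psum_pos; auto).
        lra. }
      lra. }
    simpl in H2.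
    apply (Rmult_le_reg_r (INR J + 1)); [lra|].
    rewrite Rmult_assoc, Rinv_l by lra; lra. }
  assert (H1 := psum_sq_le B' N (B J) HB').
  assert (HQ : psum (fun j => B' j ^ 2) N <= s * s * / (INR J + 1)).
  { apply Rle_trans with (B J * s); [|rewrite Rmult_assoc, Rmult_comm; apply Rmult_le_compat_l; lra].
    eapply Rle_trans; [apply H1|]; apply Rmult_le_compat_l; [auto|lra]. }
  apply Rle_trans with (s * s * / (INR J + 1) * (Cmod z ^ 2 * exp (s * Cmod z))).
  2:{ right; ring. }
  apply Rmult_le_compat; auto.
  + apply psum_pos; intros j; apply pow2_ge_0.
  + apply Rmult_le_pos; [apply pow2_ge_0|left; apply exp_pos].
  + apply Rmult_le_compat_l; [apply pow2_ge_0|]; apply Hexp; lra.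
Qed.

Lemma laguerre_limit (B : nat -> nat -> R) (N : nat -> nat) (u : nat -> R) (s : R) :
  (forall n j, 0 <= B n (S j) <= B n j) ->
  (forall n j, (N n <= j)%nat -> B n j = 0) ->
  (forall n, psum (B n) (N n) <= s) ->
  (forall k, is_lim_seq (fun n => prod_coef (B n) (N n) k) (u k)) ->
  exists (alpha : R) (beta : nat -> R),
    0 <= alpha /\ (forall j, 0 <= beta (S j) <= beta j) /\ (forall j, 0 <= beta j) /\
    ex_series beta /\
    forall z : C, exists P : C, Ccv (partial_prod beta z) P /\
      is_series (fun k => Cmult (RtoC (u k)) (Cpow z k)) (Cmult (Cexp_series alpha z) P).
Proof.
intros HB HN Hs Hu.
assert (HB0 : forall n j, 0 <= B n j).
{ intros n j; destruct (HB n j); lra. }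
(* Only the first half of [head_exp_tail_le] is wanted, so any [z] will do. *)
assert (HBs : forall n J, psum (B n) J <= psum (B n) (N n)).
{ intros n J.
  destruct (head_exp_tail_le (B n) (N n) (RtoC 0) s J) as [H _]; auto; lra. }
destruct (diagonal_extraction B s) as [phi [beta [Hphi Hbeta]]].
{ intros n j; split; auto; apply Rle_trans with (psum (B n) (S j)).
  - simpl; assert (H := psum_pos (B n) j (HB0 n)); lra.
  - eapply Rle_trans; [apply HBs|apply Hs]. }
assert (Hb0 : forall j, 0 <= beta j).
{ intros j; exact (is_lim_seq_le _ _ (Finite 0) (Finite (beta j)) (fun n => HB0 (phi n) j)
    (is_lim_seq_const 0) (Hbeta j)). }
assert (Hb1 : forall j, 0 <= beta (S j) <= beta j).
{ intros j; split; auto.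
  exact (is_lim_seq_le _ _ (Finite (beta (S j))) (Finite (beta j))
    (fun n => proj2 (HB (phi n) j)) (Hbeta (S j)) (Hbeta j)). }
assert (Hup : forall k, is_lim_seq (fun n => prod_coef (B (phi n)) (N (phi n)) k) (u k)).
{ intros k; exact (is_lim_seq_subseq _ _ phi Hphi (Hu k)). }
assert (Hsum : is_lim_seq (fun n => psum (B (phi n)) (N (phi n))) (u 1%nat)).
{ eapply is_lim_seq_ext; [|exact (Hup 1%nat)]; intros n; apply prod_coef_1. }
assert (HJ : forall J, is_lim_seq (fun n => psum (B (phi n)) J) (psum beta J)).
{ intros J; now apply (psum_cv (fun n => B (phi n))). }
assert (Hbu : forall J, psum beta J <= u 1%nat).
{ intros J; exact (is_lim_seq_le _ _ (Finite (psum beta J)) (Finite (u 1%nat))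
    (fun n => HBs (phi n) J) (HJ J) Hsum). }
assert (Hus : u 1%nat <= s).
{ exact (is_lim_seq_le _ _ (Finite (u 1%nat)) (Finite s) (fun n => Hs (phi n)) Hsum
     (is_lim_seq_const s)). }
destruct (psum_ex_series beta (u 1%nat) Hb0 Hbu) as [Hex Hser].
(* [u 1] is the limit of the full sums, the coefficient of z in a normalized product being
   [psum]. *)
set (alpha := u 1%nat - Series beta).
assert (Ha : 0 <= alpha).
{ assert (H := is_lim_seq_le _ _ (Finite (Series beta)) (Finite (u 1%nat)) Hbu Hser
     (is_lim_seq_const _)); simpl in H; unfold alpha; lra. }
exists alpha, beta; split; [auto|split; [auto|split; [auto|split; [auto|]]]].
intros z.
destruct (prod_limit beta (u 1%nat) Hb0 Hbu) as [e [_ [_ [_ HP]]]].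
destruct (HP z) as [P [_ HcvP]]; exists P; split; auto.
destruct (exp_coef_dominated_cv (fun n => prod_coef (B (phi n)) (N (phi n))) u s z
   (fun n => partial_prod (B (phi n)) z (N (phi n)))) as [F [HF HcvF]].
{ intros n k; rewrite Rabs_right by (apply Rle_ge; now apply prod_coef_pos).
  eapply Rle_trans; [now apply prod_coef_le_exp_coef|].
  apply exp_coef_incr; split; auto; now apply psum_pos. }
{ exact Hup. }
{ intros n; apply prod_coef_is_series. }
assert (HT := fun n J => head_exp_tail_le (B n) (N n) z s J (HB n) (HB0 n) (HN n) (Hs n)).
set (K := exp (s * Cmod z) * (s * s * (Cmod z ^ 2 * exp (s * Cmod z)))).
(* Limit in [n] with [J] fixed: product, head and exponent converge, and the error bound does not
   depend on [n]. *)
assert (Hbd : forall J, Cmod (Cminus F (Cmult (partial_prod beta z J)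
                (Cexp_series (u 1%nat - psum beta J) z))) <= K / (INR J + 1)).
{ intros J.
  apply (Ccv_Cmod_le (fun n => Cminus (partial_prod (B (phi n)) z (N (phi n)))
     (Cmult (partial_prod (B (phi n)) z J)
        (Cexp_series (psum (B (phi n)) (N (phi n)) - psum (B (phi n)) J) z))) _
     (fun _ => K / (INR J + 1))).
  - apply Ccv_minus; auto; apply Ccv_mult.
    + now apply (partial_prod_cv (fun n => B (phi n))).
    + apply Cexp_series_cv with s.
      * intros n; apply (HT (phi n) J).
      * now apply is_lim_seq_minus'.
      * specialize (Hbu J); lra.
  - apply is_lim_seq_const.
  - intros n; apply (HT (phi n) J). }
(* Now [J] grows; the exponents [u 1 - psum beta J] tend to [alpha]. *)
assert (Hlim : Ccv (fun J => Cminus F (Cmult (partial_prod beta z J)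
                (Cexp_series (u 1%nat - psum beta J) z))) (Cminus F (Cmult P (Cexp_series alpha z)))).
{ apply Ccv_minus; [apply Ccv_const|]; apply Ccv_mult; auto.
  apply Cexp_series_cv with s; auto.
  - intros J; assert (H := psum_pos beta J Hb0); specialize (Hbu J); lra.
  - apply is_lim_seq_minus'; [apply is_lim_seq_const|auto]. }
assert (H0 : Cminus F (Cmult P (Cexp_series alpha z)) = RtoC 0).
{ apply (Ccv_unique _ _ _ Hlim), Ccv_0.
  apply is_lim_seq_le_le with (fun _ => 0) (fun J => K / (INR J + 1)).
  - intros J; split; [apply Cmod_ge_0|apply Hbd].
  - apply is_lim_seq_const.
  - replace (Finite 0) with (Rbar_mult (Finite K) (Finite 0))
      by (simpl; now rewrite Rmult_0_r).
    apply is_lim_seq_scal_l.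
    apply (is_lim_seq_ext (fun n => / INR (S n))).
    { intros n; now rewrite S_INR. }
    apply (is_lim_seq_incr_1 (fun n => / INR n)).
    replace (Finite 0) with (Rbar_inv p_infty) by reflexivity.
    apply is_lim_seq_inv; [apply is_lim_seq_INR|discriminate]. }
assert (EF : F = Cplus (Cminus F (Cmult P (Cexp_series alpha z))) (Cmult P (Cexp_series alpha z))) by ring.
rewrite H0 in EF; rewrite EF in HF.
replace (Cmult (Cexp_series alpha z) P) with (Cplus (RtoC 0) (Cmult P (Cexp_series alpha z))); auto; ring.
Qed.

(** * From coefficientwise limits to L^+ *)

Lemma Cpow_Cmult (x y : C) k : Cpow (Cmult x y) k = Cmult (Cpow x k) (Cpow y k).
Proof. induction k as [|k IH]; simpl; [ring|rewrite IH; ring]. Qed.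

Lemma Cpow_RtoC (x : R) k : Cpow (RtoC x) k = RtoC (x ^ k).
Proof. induction k as [|k IH]; simpl; [reflexivity|now rewrite IH, RtoC_mult]. Qed.

Lemma exp_coef_exp_term s (z : C) k :
  Cmult (RtoC (exp_coef s k)) (Cpow z k) =
  Cmult (Cpow (Cmult (RtoC s) z) k) (RtoC (/ INR (fact k))).
Proof.
unfold exp_coef, Rdiv; rewrite Cpow_Cmult, Cpow_RtoC, RtoC_mult; ring.
Qed.

Lemma Cis_series_iter_shift (h : nat -> R) (z L : C) l :
  is_series (fun k => Cmult (RtoC (h k)) (Cpow z k)) L ->
  is_series (fun k => Cmult (RtoC (Nat.iter l shift h k)) (Cpow z k)) (Cmult (Cpow z l) L).
Proof.
intros H; induction l as [|l IH]; simpl.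
- now replace (Cmult (RtoC 1) L) with L by ring.
- replace (Cmult (Cmult z (Cpow z l)) L) with (Cmult z (Cmult (Cpow z l) L)) by ring.
  now apply Cis_series_shift.
Qed.

Lemma iter_shift_lt h l k : (k < l)%nat -> Nat.iter l shift h k = 0.
Proof.
revert k; induction l as [|l IH]; intros k Hk; [lia|]; simpl.
destruct k as [|k]; simpl; [reflexivity|]; apply IH; lia.
Qed.

Lemma iter_shift_add h l k : Nat.iter l shift h (l + k)%nat = h k.
Proof. induction l as [|l IH]; simpl; auto. Qed.

Lemma in_Lplus_zero (u : coefs) : (forall k, u k = RtoC 0) -> in_Lplus u.
Proof.
intros Hu.
assert (H0 : forall z : C, is_series (fun k => Cmult (u k) (Cpow z k)) (RtoC 0)).
{ intros z; apply is_series_ext with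
    (fun k => Cmult (RtoC 0) (Cmult (RtoC (exp_coef 0 k)) (Cpow z k))).
  { intros k; rewrite Hu.
    change (@eq C (Cmult (RtoC 0) (Cmult (RtoC (exp_coef 0 k)) (Cpow z k)))
                  (Cmult (RtoC 0) (Cpow z k))); ring. }
  replace (RtoC 0) with (Cmult (RtoC 0) (Cexp_series 0 z)) at 1 by ring.
  exact (is_series_scal (RtoC 0) _ _ (Cexp_series_is_series 0 z (Rle_refl 0))). }
split; [intros z; eexists; apply H0|].
exists (RtoC 0), O, 0, (fun _ => 0).
split; [lra|split; [intros; lra|split; [intros; lra|split]]].
- apply (psum_ex_series (fun _ => 0) 0); [intros; lra|].
  intros n; induction n; simpl; lra.
- intros z; exists (Cexp_series 0 z), (RtoC 1); split; [|split].
  + eapply is_series_ext; [|exact (Cexp_series_is_series 0 z (Rle_refl 0))].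
    intros k; apply exp_coef_exp_term.
  + apply filterlim_ext with (fun _ => RtoC 1); [|apply filterlim_const].
    intros n; induction n as [|n IH]; simpl; [reflexivity|rewrite <- IH; ring].
  + match goal with |- is_series _ ?x => replace x with (RtoC 0) by ring end; auto.
Qed.

Lemma least_nonzero (w : nat -> R) : (exists k, w k <> 0) ->
  exists l, w l <> 0 /\ forall k, (k < l)%nat -> w k = 0.
Proof.
intros [k Hk]; revert Hk; induction k as [k IH] using (well_founded_ind Wf_nat.lt_wf); intros Hk.
destruct (excluded_middle_informative (exists j, (j < k)%nat /\ w j <> 0)) as [[j [Hj1 Hj2]]|H].
- now apply (IH j).
- exists k; split; auto; intros j Hj; destruct (Req_dec (w j) 0); auto.
  exfalso; apply H; now exists j.
Qed.

(** Division by [z^l] and by the l-th coefficient, [l] being the order of [w] at 0, reduces this to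
    [laguerre_limit]. The bound [g n k <= w k] forbids orders below [l], and [g n l > 0] for large
    [n] forbids orders above it. *)
Lemma rooted_limit_Lplus (g : nat -> nat -> R) (w : nat -> R) (c : C) :
  (forall n, NonposRoots.rooted (g n)) -> (forall n k, 0 <= g n k <= w k) ->
  (forall k, is_lim_seq (fun n => g n k) (w k)) ->
  in_Lplus (fun k => Cmult c (RtoC (w k))).
Proof.
intros Hr Hg Hlim.
destruct (excluded_middle_informative (exists k, w k <> 0)) as [Hex|Hno].
2:{ apply in_Lplus_zero; intros k.
  destruct (Req_dec (w k) 0) as [E|E]; [rewrite E; ring|].
  exfalso; apply Hno; now exists k. }
destruct (least_nonzero w Hex) as [l [Hl Hlt]].
assert (Hw0 : forall k, 0 <= w k) by (intros k; specialize (Hg O k); lra).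
assert (Hl0 : 0 < w l) by (destruct (Hw0 l) as [H|H]; [auto|now rewrite <- H in Hl]).
(* A lower bound uniform in [n] for the normalizing coefficient; it yields the bound on the sums
   that [laguerre_limit] asks for. *)
assert (Hn0 : exists n0, forall n, (n0 <= n)%nat -> w l / 2 <= g n l).
{ assert (H := Hlim l); apply is_lim_seq_spec in H.
  assert (H2 : 0 < w l / 2) by lra.
  destruct (H (mkposreal _ H2)) as [n0 Hn0]; exists n0; intros n Hn.
  specialize (Hn0 n Hn); simpl in Hn0; apply Rabs_def2 in Hn0; lra. }
destruct Hn0 as [n0 Hn0].
set (G := fun n => g (n + n0)%nat).
assert (HGl : forall n, w l / 2 <= G n l) by (intros n; apply Hn0; lia).
assert (HG : forall n, exists p : (nat -> R) * nat,
  (forall j, 0 <= fst p (S j) <= fst p j) /\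
  (forall j, (snd p <= j)%nat -> fst p j = 0) /\
  forall k, prod_coef (fst p) (snd p) k = G n (l + k)%nat / G n l).
{ intros n.
  destruct (NonposRoots.rooted_sorted (Hr (n + n0)%nat)) as
    [cn [ln [beta [N [H1 [H2 H3]]]]]].
  fold (G n) in H3.
  assert (Hgl := HGl n).
  (* A normalized product has constant term 1, so [cn] is the coefficient at the order [ln]. *)
  assert (Hcn : cn = G n ln).
  { assert (A := H3 (ln + 0)%nat); rewrite iter_shift_add, prod_coef_0, Nat.add_0_r in A; lra. }
  assert (Hle : (ln <= l)%nat).
  { destruct (Nat.le_gt_cases ln l) as [H|H]; auto.
    rewrite (H3 l), iter_shift_lt in Hgl by auto; lra. }
  assert (Eln : ln = l).
  { destruct (Nat.eq_dec ln l) as [|H]; auto; exfalso.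
    assert (H0 : cn = 0).
    { rewrite Hcn; assert (A := Hg (n + n0)%nat ln); fold (G n) in A.
      rewrite (Hlt ln) in A by lia; lra. }
    rewrite (H3 l), H0, Rmult_0_l in Hgl; lra. }
  subst ln; exists (beta, N); simpl; split; [exact H1|split; [exact H2|]].
  intros k; rewrite (H3 (l + k)%nat), iter_shift_add, <- Hcn.
  field; rewrite Hcn; lra. }
set (p := fun n => proj1_sig (constructive_indefinite_description _ (HG n))).
assert (Hp : forall n, (forall j, 0 <= fst (p n) (S j) <= fst (p n) j) /\
  (forall j, (snd (p n) <= j)%nat -> fst (p n) j = 0) /\
  forall k, prod_coef (fst (p n)) (snd (p n)) k = G n (l + k)%nat / G n l).
{ intros n; unfold p; now destruct (constructive_indefinite_description _ (HG n)). }
assert (HGlim : forall k, is_lim_seq (fun n => G n k) (w k)).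
{ intros k; unfold G; apply (is_lim_seq_incr_n (fun n => g n k)), Hlim. }
destruct (laguerre_limit (fun n => fst (p n)) (fun n => snd (p n))
   (fun k => w (l + k)%nat / w l) (w (l + 1)%nat / (w l / 2)))
  as [alpha [beta [Ha [Hb1 [Hb0 [Hbs Hz]]]]]].
- intros n; apply (Hp n).
- intros n; apply (Hp n).
- intros n; rewrite <- prod_coef_1, (proj2 (proj2 (Hp n))).
  assert (H := HGl n); assert (A := Hg (n + n0)%nat (l + 1)%nat); fold (G n) in A.
  apply Rmult_le_compat; [lra| |lra|].
  + left; apply Rinv_0_lt_compat; lra.
  + apply Rinv_le_contravar; lra.
- intros k; eapply is_lim_seq_ext.
  { intros n; symmetry; apply (proj2 (proj2 (Hp n))). }
  apply is_lim_seq_div'; auto.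
- assert (Hser : forall z : C, exists P : C, Ccv (partial_prod beta z) P /\
    is_series (fun k => Cmult (Cmult c (RtoC (w k))) (Cpow z k))
      (Cmult (Cmult (Cmult (Cmult c (RtoC (w l))) (Cpow z l)) (Cexp_series alpha z)) P)).
  { intros z; destruct (Hz z) as [P [HP HS]]; exists P; split; auto.
    apply (Cis_series_iter_shift _ _ _ l) in HS.
    apply (is_series_scal (Cmult c (RtoC (w l)))) in HS.
    match goal with |- is_series _ ?x => replace x with
      (scal (Cmult c (RtoC (w l))) (Cmult (Cpow z l) (Cmult (Cexp_series alpha z) P))) end.
    2:{ change (@eq C (Cmult (Cmult c (RtoC (w l))) (Cmult (Cpow z l) (Cmult (Cexp_series alpha z) P)))
        (Cmult (Cmult (Cmult (Cmult c (RtoC (w l))) (Cpow z l)) (Cexp_series alpha z)) P)); ring. }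
    eapply is_series_ext; [|exact HS]; intros k.
    change (@eq C (Cmult (Cmult c (RtoC (w l)))
       (Cmult (RtoC (Nat.iter l shift (fun k0 => w (l + k0)%nat / w l) k)) (Cpow z k)))
       (Cmult (Cmult c (RtoC (w k))) (Cpow z k))).
    replace (RtoC (w k)) with (Cmult (RtoC (w l))
      (RtoC (Nat.iter l shift (fun k0 => w (l + k0)%nat / w l) k))); [ring|].
    rewrite <- RtoC_mult; f_equal.
    destruct (Nat.le_gt_cases l k) as [Hk|Hk].
    - destruct (Nat.le_exists_sub _ _ Hk) as [i [-> _]].
      rewrite Nat.add_comm, iter_shift_add; field; auto.
    - rewrite iter_shift_lt, (Hlt k) by auto; ring. }
  split; [intros z; destruct (Hser z) as [P [_ H]]; eexists; exact H|].
  exists (Cmult c (RtoC (w l))), l, alpha, beta.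
  split; [auto|split; [auto|split; [auto|split; [auto|]]]].
  intros z; destruct (Hser z) as [P [HP HS]]; exists (Cexp_series alpha z), P; split; [|split].
  + eapply is_series_ext; [|exact (Cexp_series_is_series alpha z Ha)].
    intros k; apply exp_coef_exp_term.
  + now apply Ccv_filterlim.
  + exact HS.
Qed.

(** * Norm estimates *)

Lemma normb_le_iff b (u : coefs) (M : R) : 0 < b ->
  Rbar_le (normb b u) M <-> forall k, INR (fact k) * Cmod (u k) <= M * b ^ k.
Proof.
intros Hb; unfold normb.
destruct (Lub_Rbar_correct (fun r => exists k : nat, r = / (b ^ k) * Cmod (deriv0 u k)))
  as [Hub Hlub].
assert (E : forall k, Cmod (deriv0 u k) = INR (fact k) * Cmod (u k)).
{ intros k; unfold deriv0; rewrite Cmod_mult, Cmod_R, Rabs_right; auto.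
  left; apply INR_fact_pos. }
split.
- intros H k; rewrite <- E.
  assert (H1 : Rbar_le (/ b ^ k * Cmod (deriv0 u k)) M).
  { eapply Rbar_le_trans; [apply Hub; now exists k|exact H]. }
  simpl in H1; assert (Hk : 0 < b ^ k) by now apply pow_lt.
  apply (Rmult_le_compat_l (b ^ k)) in H1; [|lra].
  rewrite <- Rmult_assoc, Rinv_r, Rmult_1_l in H1 by lra; lra.
- intros H; apply Hlub; intros x [k ->]; simpl; rewrite E.
  assert (Hk : 0 < b ^ k) by now apply pow_lt.
  apply (Rmult_le_reg_l (b ^ k)); [auto|].
  rewrite <- Rmult_assoc, Rinv_r, Rmult_1_l by lra; specialize (H k); lra.
Qed.

Lemma normb_ge0 b u : 0 < b -> Rbar_le 0 (normb b u).
Proof.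
intros Hb.
destruct (Lub_Rbar_correct (fun r => exists k : nat, r = / (b ^ k) * Cmod (deriv0 u k)))
  as [Hub _].
eapply Rbar_le_trans; [|apply Hub; now exists O].
simpl; rewrite Rinv_1, Rmult_1_l; apply Cmod_ge_0.
Qed.

Lemma normb_finite_bound b u : 0 < b -> is_finite (normb b u) ->
  0 <= real (normb b u) /\
  forall k, INR (fact k) * Cmod (u k) <= real (normb b u) * b ^ k.
Proof.
intros Hb Hf; split.
- assert (H := normb_ge0 b u Hb); rewrite <- Hf in H; exact H.
- apply normb_le_iff; auto; rewrite Hf; apply Rbar_le_refl.
Qed.

Lemma bound_normb_finite b u M : 0 < b ->
  (forall k, INR (fact k) * Cmod (u k) <= M * b ^ k) -> is_finite (normb b u).
Proof.
intros Hb H; apply (normb_le_iff b u M Hb) in H.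
assert (H0 := normb_ge0 b u Hb).
now apply is_finite_correct; destruct (normb b u); [eexists| |].
Qed.

(** * Rising factorials and the negative binomial series *)

Fixpoint rising (p : R) (k : nat) : R :=
  match k with O => 1 | S k' => p * rising (p + 1) k' end.

(** The definition shifts the base, in keeping with [dcoef_S]; Pascal's rule needs the last factor
    split off instead. *)
Lemma rising_S p k : rising p (S k) = (p + INR k) * rising p k.
Proof.
revert p; induction k as [|k IH]; intros p; [simpl; ring|].
change (rising p (S (S k))) with (p * rising (p + 1) (S k)).
rewrite IH, S_INR; simpl; ring.
Qed.

Lemma rising_pos p k : 0 <= p -> 0 <= rising p k.
Proof.
revert p; induction k as [|k IH]; intros p Hp; simpl; [lra|].
apply Rmult_le_pos; [auto|apply IH; lra].
Qed.

Lemma rising_le p q k : 0 <= p <= q -> rising p k <= rising q k.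
Proof.
revert p q; induction k as [|k IH]; intros p q H; simpl; [lra|].
apply Rmult_le_compat; [lra|apply rising_pos; lra|lra|apply IH; lra].
Qed.

(** Partial sums of [(1 - x) (1 - x)^-(p+1) = (1 - x)^-p] with exact remainder, from Pascal's rule
    for [rising p k / k!]. *)
Lemma negbin_step x p K :
  (1 - x) * sum_f_R0 (fun k => x ^ k * (rising (p + 1) k / INR (fact k))) K =
  sum_f_R0 (fun k => x ^ k * (rising p k / INR (fact k))) K
  - x ^ S K * (rising (p + 1) K / INR (fact K)).
Proof.
induction K as [|K IH]; [simpl; field|].
rewrite !tech5, Rmult_plus_distr_l, IH.
assert (E : rising (p + 1) (S K) / INR (fact (S K)) =
            rising p (S K) / INR (fact (S K)) + rising (p + 1) K / INR (fact K)).
{ rewrite (rising_S (p + 1)); change (rising p (S K)) with (p * rising (p + 1) K).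
  rewrite INR_fact_S; assert (H := INR_fact_pos K); assert (H' := pos_INR K).
  field; lra. }
rewrite E; simpl pow; ring.
Qed.

(** Induction on the exponent by [negbin_step], dropping its nonnegative remainder; for exponent 0
    only the term [k = 0] survives. *)
Lemma negbin_partial_le x m K : 0 <= x < 1 ->
  sum_f_R0 (fun k => x ^ k * (rising (INR m) k / INR (fact k))) K <= (/ (1 - x)) ^ m.
Proof.
intros Hx; induction m as [|m IH].
- induction K as [|K IH]; [simpl; lra|].
  rewrite tech5; change (rising (INR 0) (S K)) with (0 * rising (0 + 1) K).
  unfold Rdiv; rewrite !Rmult_0_l, Rmult_0_r, Rplus_0_r; exact IH.
- assert (Hs := negbin_step x (INR m) K).
  assert (0 <= x ^ S K * (rising (INR m + 1) K / INR (fact K))).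
  { apply Rmult_le_pos; [apply pow_le; lra|].
    apply Rmult_le_pos; [apply rising_pos; assert (H := pos_INR m); lra|].
    left; apply Rinv_0_lt_compat, INR_fact_pos. }
  rewrite S_INR; simpl pow.
  apply (Rmult_le_reg_l (1 - x)); [lra|].
  rewrite <- Rmult_assoc, Rinv_r, Rmult_1_l by lra; lra.
Qed.

(** A real exponent is reached by monotonicity of [rising] in its base; the integer [m] keeps the
    bound a natural power. *)
Lemma negbin_series x p m : 0 <= x < 1 -> 0 <= p <= INR m ->
  ex_series (fun k => x ^ k * (rising p k / INR (fact k))) /\
  Series (fun k => x ^ k * (rising p k / INR (fact k))) <= (/ (1 - x)) ^ m.
Proof.
intros Hx Hp.
set (a := fun k => x ^ k * (rising p k / INR (fact k))).
assert (Ha : forall k, 0 <= a k).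
{ intros k; apply Rmult_le_pos; [apply pow_le; lra|].
  apply Rmult_le_pos; [apply rising_pos; lra|].
  left; apply Rinv_0_lt_compat, INR_fact_pos. }
assert (Hb : forall K, sum_n a K <= (/ (1 - x)) ^ m).
{ intros K; rewrite sum_n_Reals.
  eapply Rle_trans; [|apply (negbin_partial_le x m K Hx)].
  apply sum_Rle; intros k _; apply Rmult_le_compat_l; [apply pow_le; lra|].
  apply Rmult_le_compat_r; [left; apply Rinv_0_lt_compat, INR_fact_pos|].
  now apply rising_le. }
destruct (ex_finite_lim_seq_incr (sum_n a) ((/ (1 - x)) ^ m)) as [l Hl]; auto.
{ intros n; rewrite sum_Sn; change (sum_n a n <= sum_n a n + a (S n)).
  specialize (Ha (S n)); lra. }
assert (He : is_series a l) by exact Hl.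
split; [now exists l|].
rewrite (is_series_unique _ _ He).
exact (is_lim_seq_le _ _ (Finite l) (Finite _) Hb Hl (is_lim_seq_const _)).
Qed.

(** * Size of the coefficients of [phi(Delta) f] *)

Lemma dcoef_S theta k n :
  dcoef theta (S k) (n + S k) = (INR n + 1) * (INR n + theta) * dcoef theta k (S n + k).
Proof.
replace (n + S k)%nat with (S n + k)%nat by lia.
change (dcoef theta (S k) (S n + k)) with
  (dcoef theta k (S n + k) * INR (S n + k - k) * (INR (S n + k - k) - 1 + theta)).
replace (S n + k - k)%nat with (S n) by lia; rewrite S_INR; ring.
Qed.

Lemma dcoef_rising theta k n :
  dcoef theta k (n + k) = INR (fact (n + k)) / INR (fact n) * rising (INR n + theta) k.
Proof.
revert n; induction k as [|k IH]; intros n.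
- rewrite Nat.add_0_r; simpl; field; apply Rgt_not_eq, INR_fact_pos.
- rewrite dcoef_S, IH, INR_fact_S, S_INR; simpl rising.
  replace (n + S k)%nat with (S n + k)%nat by lia.
  replace (INR n + 1 + theta) with (INR n + theta + 1) by ring.
  assert (H := INR_fact_pos n); assert (H' := pos_INR n); field; lra.
Qed.

Lemma dcoef_pos theta k n : 0 <= theta -> 0 <= dcoef theta k (n + k).
Proof.
intros Ht; rewrite dcoef_rising; apply Rmult_le_pos.
- apply Rmult_le_pos; [left; apply INR_fact_pos|].
  left; apply Rinv_0_lt_compat, INR_fact_pos.
- apply rising_pos; assert (H := pos_INR n); lra.
Qed.

Section Bound.

Variables (theta b1 b2 M N : R) (m : nat) (phi f : coefs).
Hypotheses (Ht : 0 <= theta) (Hm : theta <= INR m) (Hb1 : 0 < b1) (Hb2 : 0 < b2)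
  (Hx : b1 * b2 < 1)
  (Hphi : forall k, INR (fact k) * Cmod (phi k) <= M * b1 ^ k)
  (Hf : forall k, INR (fact k) * Cmod (f k) <= N * b2 ^ k).

Lemma Dop_term_le n k :
  Cmod (Dop_term theta phi f n k) <=
  M * N * b2 ^ n / INR (fact n) *
    ((b1 * b2) ^ k * (rising (INR n + theta) k / INR (fact k))).
Proof.
unfold Dop_term; rewrite !Cmod_mult, Cmod_R, Rabs_right
  by (apply Rle_ge; now apply dcoef_pos).
rewrite dcoef_rising.
assert (F1 := INR_fact_pos n); assert (F2 := INR_fact_pos k).
assert (F3 := INR_fact_pos (n + k)).
assert (Hr : 0 <= rising (INR n + theta) k).
{ apply rising_pos; assert (H := pos_INR n); lra. }
assert (H1 := Hphi k); assert (H2 := Hf (n + k)%nat).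
assert (H3 : INR (fact k) * Cmod (phi k) * (INR (fact (n + k)) * Cmod (f (n + k)%nat))
  <= M * b1 ^ k * (N * b2 ^ (n + k))).
{ apply Rmult_le_compat; auto; apply Rmult_le_pos; try lra; apply Cmod_ge_0. }
apply (Rmult_le_compat_r (rising (INR n + theta) k / (INR (fact n) * INR (fact k)))) in H3.
2:{ apply Rmult_le_pos; auto; left; apply Rinv_0_lt_compat; nra. }
eapply Rle_trans; [|eapply Rle_trans; [exact H3|]]; right.
- field; lra.
- rewrite Rpow_mult_distr, pow_add; field; lra.
Qed.

Lemma Dop_term_series n :
  ex_series (fun k => Cmod (Dop_term theta phi f n k)) /\
  is_series (Dop_term theta phi f n) (Dop theta phi f n) /\
  INR (fact n) * Cmod (Dop theta phi f n) <=
    M * N * b2 ^ n * (/ (1 - b1 * b2)) ^ (n + m).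
Proof.
set (x := b1 * b2) in *.
set (a := fun k => x ^ k * (rising (INR n + theta) k / INR (fact k))).
assert (Hx0 : 0 <= x) by (unfold x; nra).
assert (F1 := INR_fact_pos n).
destruct (negbin_series x (INR n + theta) (n + m)) as [Hex Hle]; [lra| |].
{ rewrite plus_INR; assert (H := pos_INR n); lra. }
fold a in Hex, Hle.
set (c := M * N * b2 ^ n / INR (fact n)).
assert (Hs : is_series (fun k => c * a k) (c * Series a)).
{ apply (is_series_scal c a (Series a)), Series_correct, Hex. }
assert (Hd : ex_series (fun k => Cmod (Dop_term theta phi f n k))).
{ apply (Rex_series_le _ (fun k => c * a k)); [|now eexists; exact Hs].
  intros k; rewrite Rabs_right by (apply Rle_ge, Cmod_ge_0); apply Dop_term_le. }
assert (He : ex_series (Dop_term theta phi f n)).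
{ apply (Cex_series_le _ _ Hd); intros k; lra. }
assert (Hi : is_series (Dop_term theta phi f n) (Dop theta phi f n)).
{ destruct He as [l Hl]; apply Cis_series in Hl; destruct Hl as [H1 H2].
  apply Cis_series; split; apply Series_correct; eexists; eassumption. }
split; [auto|split; [auto|]].
assert (H := Cseries_Cmod_le _ _ _ _ Hi Hs (fun k => Dop_term_le n k)).
assert (HM : 0 <= M).
{ assert (H1 := Hphi 0%nat); simpl in H1; assert (H2 := Cmod_ge_0 (phi 0%nat)); lra. }
assert (HN : 0 <= N).
{ assert (H1 := Hf 0%nat); simpl in H1; assert (H2 := Cmod_ge_0 (f 0%nat)); lra. }
apply Rle_trans with (INR (fact n) * (c * (/ (1 - x)) ^ (n + m))).
- apply Rmult_le_compat_l; [lra|].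
  eapply Rle_trans; [exact H|]; apply Rmult_le_compat_l; auto.
  unfold c; apply Rmult_le_pos; [|left; now apply Rinv_0_lt_compat].
  apply Rmult_le_pos; [nra|apply pow_le; lra].
- right; unfold c; field; lra.
Qed.

(** The power [n] of [1/(1 - b1 b2)] joins [b2^n] to give the ratio [b2/(1 - b1 b2) <= b3]; the
    power [m] remains as a constant. *)
Lemma Dop_bound b3 : b2 <= b3 * (1 - b1 * b2) -> forall n,
  INR (fact n) * Cmod (Dop theta phi f n) <= M * N * (/ (1 - b1 * b2)) ^ m * b3 ^ n.
Proof.
intros H3 n.
assert (HM : 0 <= M).
{ assert (H1 := Hphi 0%nat); simpl in H1; assert (H2 := Cmod_ge_0 (phi 0%nat)); lra. }
assert (HN : 0 <= N).
{ assert (H1 := Hf 0%nat); simpl in H1; assert (H2 := Cmod_ge_0 (f 0%nat)); lra. }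
eapply Rle_trans; [apply Dop_term_series|].
set (y := / (1 - b1 * b2)).
assert (Hy : 0 < y) by (apply Rinv_0_lt_compat; lra).
rewrite pow_add.
replace (M * N * b2 ^ n * (y ^ n * y ^ m)) with (M * N * y ^ m * (b2 * y) ^ n)
  by (rewrite Rpow_mult_distr; ring).
apply Rmult_le_compat_l.
- apply Rmult_le_pos; [nra|apply pow_le; lra].
- apply pow_incr; split; [nra|].
  apply (Rmult_le_reg_r (1 - b1 * b2)); [lra|].
  unfold y; rewrite Rmult_assoc, Rinv_l by lra; lra.
Qed.

End Bound.

(** * Approximation by polynomials *)

(** Generated factor by factor so that [phi(Delta)] can be composed one factor at a time. Scalars
    are left to the constant [c] of L^+. *)
Inductive factored : (nat -> R) -> Prop :=
| factored_one_coef : factored one_coef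
| factored_shift h : factored h -> factored (shift h)
| factored_mul_linear w h : 0 <= w -> factored h -> factored (mul_linear w h).

Lemma factored_prod_coef beta n : (forall j, 0 <= beta j) -> factored (prod_coef beta n).
Proof. intros Hb; induction n; simpl; constructor; auto. Qed.

Lemma factored_iter_shift l h : factored h -> factored (Nat.iter l shift h).
Proof. intros Hh; induction l; simpl; auto; now constructor. Qed.

Lemma factored_iter_mul_linear w n h : 0 <= w -> factored h -> factored (Nat.iter n (mul_linear w) h).
Proof. intros Hw Hh; induction n; simpl; auto; now constructor. Qed.

Lemma factored_rooted h : factored h -> NonposRoots.rooted h.
Proof.
induction 1.
- apply NonposRoots.rooted_one_coef.
- now apply NonposRoots.rooted_shift.
- now apply NonposRoots.rooted_mul_linear.
Qed.

Lemma factored_support h : factored h -> exists K, forall k, (K <= k)%nat -> h k = 0.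
Proof.
induction 1 as [|h _ [K IH]|w h _ _ [K IH]].
- exists 1%nat; intros [|k] Hk; [lia|reflexivity].
- exists (S K); intros [|k] Hk; [reflexivity|]; apply IH; lia.
- exists (S K); intros [|k] Hk; [lia|]; unfold mul_linear; simpl.
  rewrite !IH by lia; ring.
Qed.

Lemma rooted_ext h g : (forall k, h k = g k) -> NonposRoots.rooted h -> NonposRoots.rooted g.
Proof.
intros E [c [xs [H1 H2]]]; exists c, xs; split; auto.
intros k; rewrite <- E; apply H2.
Qed.

(** * The operator on polynomials *)

Definition real_Dop_term (theta : R) (phi f : nat -> R) (n k : nat) : R :=
  phi k * f (n + k)%nat * dcoef theta k (n + k).

Definition real_Dop (theta : R) (phi f : nat -> R) (n : nat) : R :=
  Series (real_Dop_term theta phi f n).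

Lemma ex_series_finite_support (a : nat -> R) K :
  (forall k, (K <= k)%nat -> a k = 0) -> ex_series a.
Proof.
intros H; apply (ex_series_incr_n a K).
exists 0; apply filterlim_ext with (fun _ => 0); [|apply filterlim_const].
intros k; rewrite (sum_n_ext _ (fun _ => 0)) by (intros; apply H; lia).
rewrite sum_n_const; symmetry; apply Rmult_0_r.
Qed.

Lemma real_Dop_term_ex_series theta phi f n : factored phi -> ex_series (real_Dop_term theta phi f n).
Proof.
intros H; destruct (factored_support phi H) as [K HK].
apply ex_series_finite_support with K; intros k Hk; unfold real_Dop_term; rewrite HK by auto; ring.
Qed.

Lemma real_Dop_one_coef theta f n : real_Dop theta one_coef f n = f n.
Proof.
unfold real_Dop; rewrite Series_incr_1 by (apply real_Dop_term_ex_series; constructor).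
rewrite (Series_ext _ (fun _ => 0 * 0)) by (intros k; unfold real_Dop_term; simpl; ring).
rewrite Series_scal_l; unfold real_Dop_term; simpl; rewrite Nat.add_0_r; ring.
Qed.

(** This is [(z phi)(Delta) f = Delta (phi(Delta) f)], read at z^n. *)
Lemma real_Dop_shift theta phi f n : factored phi ->
  real_Dop theta (shift phi) f n =
  (INR n + 1) * (INR n + theta) * real_Dop theta phi f (S n).
Proof.
intros H; unfold real_Dop; rewrite Series_incr_1 by (apply real_Dop_term_ex_series; now constructor).
rewrite <- Series_scal_l.
replace (real_Dop_term theta (shift phi) f n 0) with 0 by (unfold real_Dop_term; simpl; ring).
rewrite Rplus_0_l; apply Series_ext; intros k; unfold real_Dop_term; simpl shift.
rewrite dcoef_S; replace (n + S k)%nat with (S n + k)%nat by lia; ring.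
Qed.

Lemma real_Dop_mul_linear theta w phi f n : factored phi ->
  real_Dop theta (mul_linear w phi) f n = real_Dop theta phi f n + w * real_Dop theta (shift phi) f n.
Proof.
intros H; unfold real_Dop; rewrite <- Series_scal_l, <- Series_plus.
- apply Series_ext; intros k; unfold real_Dop_term, mul_linear; ring.
- now apply real_Dop_term_ex_series.
- destruct (real_Dop_term_ex_series theta (shift phi) f n) as [l Hl]; [now constructor|].
  exists (w * l); exact (is_series_scal w _ l Hl).
Qed.

(** Each factor of [phi] acts as a [delta_comb]: [z] as [Delta], and [1 + w z] as [1 + w Delta];
    both preserve [rooted]. *)
Lemma rooted_real_Dop theta phi f : 0 <= theta -> factored phi -> factored f ->
  NonposRoots.rooted (real_Dop theta phi f).
Proof.
intros Ht Hp Hf; induction Hp as [|h Hh IH|w h Hw Hh IH].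
- apply rooted_ext with f; [intros k; now rewrite real_Dop_one_coef|].
  now apply factored_rooted.
- apply rooted_ext with (delta_comb theta 0 1 (real_Dop theta h f)).
  + intros k; unfold delta_comb; rewrite real_Dop_shift by auto; ring.
  + apply NonposRoots.rooted_delta_comb; auto; lra.
- apply rooted_ext with (delta_comb theta 1 w (real_Dop theta h f)).
  + intros k; unfold delta_comb; rewrite real_Dop_mul_linear, real_Dop_shift by auto; ring.
  + apply NonposRoots.rooted_delta_comb; auto; lra.
Qed.

(** * Cauchy products and the approximation of exponentials *)

Definition conv (g h : nat -> R) (k : nat) : R := sum_f_R0 (fun i => g i * h (k - i)%nat) k.

Lemma conv_one_coef h k : conv one_coef h k = h k.
Proof.
unfold conv; destruct k as [|k]; [simpl; ring|].
rewrite decomp_sum by lia; simpl pred.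
rewrite (sum_eq _ (fun _ => 0)) by (intros; simpl; ring).
rewrite sum_eq_R0 by auto; simpl; ring.
Qed.

Lemma conv_mul_linear w g h k : conv (mul_linear w g) h k = mul_linear w (conv g h) k.
Proof.
unfold conv, mul_linear.
rewrite (sum_eq _ (fun i => g i * h (k - i)%nat + shift g i * h (k - i)%nat * w))
  by (intros; ring).
rewrite sum_plus, <- scal_sum; f_equal; f_equal.
destruct k as [|k]; [simpl; ring|].
rewrite decomp_sum by lia; simpl pred; simpl shift; rewrite Rmult_0_l, Rplus_0_l.
reflexivity.
Qed.

(** The iterated form shows that an approximant is [factored]; the Cauchy product is the form in
    which bounds and limits of its two parts combine. *)
Lemma iter_mul_linear_conv w m h k : Nat.iter m (mul_linear w) h k = conv (prod_coef (fun _ => w) m) h k.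
Proof.
revert k; induction m as [|m IH]; intros k; simpl; [now rewrite conv_one_coef|].
rewrite conv_mul_linear; unfold mul_linear; rewrite IH; f_equal; f_equal.
destruct k; simpl; auto.
Qed.

Lemma conv_le g g' h h' k : (forall i, 0 <= g i <= g' i) -> (forall i, 0 <= h i <= h' i) ->
  0 <= conv g h k <= conv g' h' k.
Proof.
intros Hg Hh; split.
- apply cond_pos_sum; intros i; apply Rmult_le_pos; [apply Hg|apply Hh].
- apply sum_Rle; intros i _; apply Rmult_le_compat;
    [apply Hg|apply Hh|apply Hg|apply Hh].
Qed.

Lemma conv_cv (g h : nat -> nat -> R) (g' h' : nat -> R) k :
  (forall i, is_lim_seq (fun n => g n i) (g' i)) ->
  (forall i, is_lim_seq (fun n => h n i) (h' i)) ->
  is_lim_seq (fun n => conv (g n) (h n) k) (conv g' h' k).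
Proof.
intros Hg Hh; unfold conv; generalize k at 2 4; intros m.
induction m as [|m IH]; simpl; [now apply is_lim_seq_mult'|].
apply is_lim_seq_plus'; auto; now apply is_lim_seq_mult'.
Qed.

Lemma psum_const w n : psum (fun _ => w) n = INR n * w.
Proof.
induction n as [|n IH]; [simpl; ring|].
rewrite S_INR; simpl psum; rewrite IH; ring.
Qed.

(** For [(1 + alpha z/(n+1))^(n+1)] the sum of squares in [exp_coef_sub_prod_coef_le] is
    [alpha^2/(n+1)]. The index [S n] avoids division by zero. *)
Lemma prod_coef_const_cv alpha k : 0 <= alpha ->
  (forall n, prod_coef (fun _ => alpha / INR (S n)) (S n) k <= exp_coef alpha k) /\
  is_lim_seq (fun n => prod_coef (fun _ => alpha / INR (S n)) (S n) k) (exp_coef alpha k).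
Proof.
intros Ha.
assert (Hp : forall n, 0 <= alpha / INR (S n)).
{ intros n; apply Rmult_le_pos; auto; left; apply Rinv_0_lt_compat, lt_0_INR; lia. }
assert (Hs : forall n, psum (fun _ => alpha / INR (S n)) (S n) = alpha).
{ intros n; rewrite psum_const; field; apply not_0_INR; lia. }
assert (Hle : forall n, prod_coef (fun _ => alpha / INR (S n)) (S n) k <= exp_coef alpha k).
{ intros n; assert (A := prod_coef_le_exp_coef (fun _ => alpha / INR (S n)) (S n) k (fun _ => Hp n)).
  now rewrite Hs in A. }
split; auto.
set (Q := alpha ^ 2 * shift (shift (exp_coef alpha)) k).
apply is_lim_seq_le_le with (fun n => exp_coef alpha k - Q * / INR (S n)) (fun _ => exp_coef alpha k).
- intros n; split; auto.
  assert (H := exp_coef_sub_prod_coef_le (fun _ => alpha / INR (S n)) (S n) k (fun _ => Hp n)).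
  rewrite Hs, psum_const in H.
  replace (Q * / INR (S n)) with
    (INR (S n) * (alpha / INR (S n)) ^ 2 * shift (shift (exp_coef alpha)) k); [lra|].
  unfold Q; field; apply not_0_INR; lia.
- replace (Finite (exp_coef alpha k)) with (Finite (exp_coef alpha k - Q * 0)) by (f_equal; ring).
  apply is_lim_seq_minus'; [apply is_lim_seq_const|].
  apply is_lim_seq_mult'; [apply is_lim_seq_const|].
  apply (is_lim_seq_incr_1 (fun n => / INR n)).
  replace (Finite 0) with (Rbar_inv p_infty) by reflexivity.
  apply is_lim_seq_inv; [apply is_lim_seq_INR|discriminate].
- apply is_lim_seq_const.
Qed.

(** * Uniqueness of coefficients and approximation of L^+ from below *)

Lemma coef_unique_R (d : nat -> R) :
  (forall x, is_series (fun k => d k * x ^ k) 0) -> forall k, d k = 0.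
Proof.
intros H k.
assert (HP : forall x, PSeries d x = 0).
{ intros x; apply is_series_unique; apply H. }
(* Convergence at [x = 1] already excludes radius 0. *)
assert (Hc : Rbar_lt 0 (CV_radius d)).
{ apply Rbar_not_le_lt; intros Hle; apply (CV_disk_outside d 1).
  - eapply Rbar_le_lt_trans; [exact Hle|]; rewrite Rabs_R1; simpl; lra.
  - apply ex_series_lim_0; eexists; apply H. }
change (d k = (fun _ : nat => 0) k).
apply PSeries_ext_recip; auto.
- rewrite CV_radius_const_0; exact I.
- apply filter_forall; intros x; rewrite HP; symmetry; apply PSeries_const_0.
Qed.

Lemma is_series_RtoC (a : nat -> R) (l : R) :
  is_series a l -> is_series (fun k => RtoC (a k)) (RtoC l).
Proof.
intros H; apply Cis_series; split; [exact H|]; simpl.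
apply filterlim_ext with (fun _ => 0); [|apply filterlim_const].
intros k; rewrite sum_n_const; symmetry; apply Rmult_0_r.
Qed.

(** Real arguments suffice: there [x^k] is real, so the real and imaginary parts of the difference
    are real power series that vanish identically. *)
Lemma coef_unique (u : coefs) (c : C) (v : nat -> R) :
  (forall x : R, exists l : R, is_series (fun k => v k * x ^ k) l /\
     is_series (fun k => Cmult (u k) (Cpow (RtoC x) k)) (Cmult c (RtoC l))) ->
  forall k, u k = Cmult c (RtoC (v k)).
Proof.
intros H.
assert (Hd : forall x : R, is_series
   (fun k => Cmult (Cminus (u k) (Cmult c (RtoC (v k)))) (RtoC (x ^ k))) (RtoC 0)).
{ intros x; destruct (H x) as [l [H1 H2]].
  apply is_series_RtoC, (is_series_scal c) in H1.
  assert (H3 := is_series_minus _ _ _ _ H2 H1).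
  match type of H3 with is_series _ ?y => replace y with (RtoC 0) in H3 end.
  2:{ change (@eq C (RtoC 0) (Cminus (Cmult c (RtoC l)) (Cmult c (RtoC l)))); ring. }
  eapply is_series_ext; [|exact H3]; intros k.
  change (@eq C (Cminus (Cmult (u k) (Cpow (RtoC x) k)) (Cmult c (RtoC (v k * x ^ k))))
    (Cmult (Cminus (u k) (Cmult c (RtoC (v k)))) (RtoC (x ^ k)))).
  rewrite Cpow_RtoC, RtoC_mult; ring. }
intros k.
assert (E1 : fst (Cminus (u k) (Cmult c (RtoC (v k)))) = 0).
{ apply (coef_unique_R (fun k => fst (Cminus (u k) (Cmult c (RtoC (v k)))))).
  intros x; specialize (Hd x); apply Cis_series in Hd; destruct Hd as [Hd _].
  eapply Ris_series_ext; [|exact Hd]; intros j; simpl; ring. }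
assert (E2 : snd (Cminus (u k) (Cmult c (RtoC (v k)))) = 0).
{ apply (coef_unique_R (fun k => snd (Cminus (u k) (Cmult c (RtoC (v k)))))).
  intros x; specialize (Hd x); apply Cis_series in Hd; destruct Hd as [_ Hd].
  eapply Ris_series_ext; [|exact Hd]; intros j; simpl; ring. }
assert (E : Cminus (u k) (Cmult c (RtoC (v k))) = RtoC 0).
{ apply injective_projections; auto. }
replace (u k) with (Cplus (Cminus (u k) (Cmult c (RtoC (v k)))) (Cmult c (RtoC (v k)))) by ring.
rewrite E; ring.
Qed.

Lemma iter_shift_le l h g k : (forall k, 0 <= h k <= g k) ->
  0 <= Nat.iter l shift h k <= Nat.iter l shift g k.
Proof.
intros H; revert k; induction l as [|l IH]; intros k; simpl; auto.
destruct k; simpl; [lra|auto].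
Qed.

Lemma iter_shift_cv l (h : nat -> nat -> R) (g : nat -> R) k :
  (forall k, is_lim_seq (fun n => h n k) (g k)) ->
  is_lim_seq (fun n => Nat.iter l shift (h n) k) (Nat.iter l shift g k).
Proof.
intros H; revert k; induction l as [|l IH]; intros k; simpl; auto.
destruct k; simpl; [apply is_lim_seq_const|auto].
Qed.

Lemma is_series_iter_shift (h : nat -> R) (r L : R) l :
  is_series (fun k => h k * r ^ k) L ->
  is_series (fun k => Nat.iter l shift h k * r ^ k) (r ^ l * L).
Proof.
intros H; induction l as [|l IH]; simpl; [now rewrite Rmult_1_l|].
rewrite Rmult_assoc; now apply is_series_shift.
Qed.

(** The representation in L^+ is an identity of functions, turned into one of coefficients by
    [coef_unique]. Apart from [c] all factors have nonnegative coefficients, so truncating the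
    product and replacing the exponential only lowers them. *)
Lemma Lplus_approx (u : coefs) : in_Lplus u ->
  exists (c : C) (v : nat -> R) (V : nat -> nat -> R),
    (forall k, u k = Cmult c (RtoC (v k))) /\
    (forall n, factored (V n)) /\ (forall n k, 0 <= V n k <= v k) /\
    (forall k, is_lim_seq (fun n => V n k) (v k)).
Proof.
intros [_ [c [l [alpha [beta [Ha [Hb1 [Hb0 [Hbs Hz]]]]]]]]].
assert (Hbb : forall n, psum beta n <= Series beta).
{ intros n; apply Rle_trans with (psum beta (S n)).
  { simpl; specialize (Hb0 n); lra. }
  rewrite psum_sum_n; apply is_lim_seq_incr_compare.
  - apply (Series_correct beta Hbs).
  - intros m; rewrite sum_Sn; change (sum_n beta m <= sum_n beta m + beta (S m)).
    specialize (Hb0 (S m)); lra. }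
destruct (prod_limit beta (Series beta) Hb0 Hbb) as [e [He1 [He2 [He3 HeP]]]].
assert (He0 : forall k, 0 <= e k).
{ intros k; eapply Rle_trans; [apply (prod_coef_pos beta 0 k Hb0)|apply He2]. }
set (W := fun n => Nat.iter (S n) (mul_linear (alpha / INR (S n))) (prod_coef beta n)).
assert (Hp : forall n, 0 <= alpha / INR (S n)).
{ intros n; apply Rmult_le_pos; auto; left; apply Rinv_0_lt_compat, lt_0_INR; lia. }
exists c, (Nat.iter l shift (conv (exp_coef alpha) e)), (fun n => Nat.iter l shift (W n)).
split; [|split; [|split]].
- apply coef_unique; intros x.
  assert (S1 := is_series_exp_coef alpha x).
  (* The Cauchy product of the exponential and the infinite product requires absolute convergence of
     both series. *)
  assert (X2 : ex_series (fun k => Rabs (e k * x ^ k))).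
  { apply Rex_series_le with (fun k => exp_coef (Series beta) k * Rabs x ^ k).
    - intros k; rewrite Rabs_Rabsolu, Rabs_mult, <- RPow_abs, (Rabs_right (e k))
        by (apply Rle_ge; auto).
      apply Rmult_le_compat_r; auto; apply pow_le, Rabs_pos.
    - eexists; apply is_series_exp_coef. }
  assert (X1 : ex_series (fun k => Rabs (exp_coef alpha k * x ^ k))).
  { apply Rex_series_le with (fun k => exp_coef alpha k * Rabs x ^ k).
    - intros k; rewrite Rabs_Rabsolu, Rabs_mult, <- RPow_abs, (Rabs_right (exp_coef alpha k))
        by (apply Rle_ge; now apply exp_coef_pos); lra.
    - eexists; apply is_series_exp_coef. }
  assert (S2 := Series_correct _ (ex_series_Rabs _ X2)).
  set (L := Series (fun k => e k * x ^ k)) in S2.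
  exists (x ^ l * (exp (alpha * x) * L)); split.
  + apply is_series_iter_shift.
    eapply Ris_series_ext; [|exact (is_series_mult _ _ _ _ S1 S2 X1 X2)].
    intros k; unfold conv; rewrite Rmult_comm, scal_sum; apply sum_eq; intros i Hi.
    replace (x ^ k) with (x ^ i * x ^ (k - i)); [ring|].
    rewrite <- pow_add; f_equal; lia.
  + destruct (Hz (RtoC x)) as [E [P [HE [HP HS]]]].
    assert (EE : E = RtoC (exp (alpha * x))).
    { apply (Cis_series_unique _ _ _ HE).
      eapply is_series_ext; [|exact (is_series_RtoC _ _ S1)]; intros k.
      rewrite <- exp_coef_exp_term, Cpow_RtoC; apply RtoC_mult. }
    assert (EP : P = RtoC L).
    { destruct (HeP (RtoC x)) as [P' [HP1 HP2]].
      apply Ccv_filterlim in HP; rewrite (Ccv_unique _ _ _ HP HP2).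
      apply (Cis_series_unique _ _ _ HP1).
      eapply is_series_ext; [|exact (is_series_RtoC _ _ S2)]; intros k.
      rewrite Cpow_RtoC; apply RtoC_mult. }
    rewrite EE, EP, Cpow_RtoC in HS.
    replace (Cmult c (RtoC (x ^ l * (exp (alpha * x) * L)))) with
      (Cmult (Cmult (Cmult c (RtoC (x ^ l))) (RtoC (exp (alpha * x)))) (RtoC L)); auto.
    rewrite !RtoC_mult; ring.
- intros n; apply factored_iter_shift, factored_iter_mul_linear; auto; now apply factored_prod_coef.
- intros n k; apply iter_shift_le; intros j; unfold W; rewrite iter_mul_linear_conv.
  apply conv_le; intros i; split.
  + apply prod_coef_pos; intros _; apply Hp.
  + now apply prod_coef_const_cv.
  + now apply prod_coef_pos.
  + apply He2.
- intros k; apply iter_shift_cv; intros j.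
  apply is_lim_seq_ext with
    (fun n => conv (prod_coef (fun _ => alpha / INR (S n)) (S n)) (prod_coef beta n) j).
  { intros n; unfold W; now rewrite iter_mul_linear_conv. }
  apply (conv_cv (fun n => prod_coef (fun _ => alpha / INR (S n)) (S n)) (prod_coef beta)); auto.
  intros i; now apply prod_coef_const_cv.
Qed.

(** * Choice of radii, membership in L^+ and continuity *)

Lemma radius_choice a b b3 : 0 <= a -> 0 <= b -> a * b < 1 -> b / (1 - a * b) < b3 ->
  exists b1 b2, a < b1 /\ b < b2 /\ b1 * b2 < 1 /\ b2 <= b3 * (1 - b1 * b2) /\ 0 < b3.
Proof.
intros Ha Hb Hab H3.
assert (Hc : 0 <= b / (1 - a * b)).
{ apply Rmult_le_pos; auto; left; apply Rinv_0_lt_compat; lra. }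
assert (H3' : b < b3 * (1 - a * b)).
{ apply (Rmult_lt_compat_r (1 - a * b)) in H3; [|lra].
  unfold Rdiv in H3; rewrite Rmult_assoc, Rinv_l, Rmult_1_r in H3 by lra; lra. }
assert (Hb3 : 0 < b3) by lra.
(* With [b1 = a + e] and [b2 = b + e] the inequality [b2 <= b3 (1 - b1 b2)] reads
   [e (1 + b3 (a + b + e)) <= D], and [e <= 1] bounds the left side by [e T]. *)
set (D := b3 * (1 - a * b) - b); set (T := 1 + b3 * (a + b + 1)).
assert (HD : 0 < D) by (unfold D; lra).
assert (HT : 0 < T) by (unfold T; assert (0 <= b3 * (a + b + 1)) by nra; lra).
set (e := Rmin 1 (D / T)).
assert (He0 : 0 < e).
{ unfold e; apply Rmin_glb_lt; [lra|]; apply Rmult_lt_0_compat; auto.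
  now apply Rinv_0_lt_compat. }
assert (He1 : e <= 1) by apply Rmin_l.
assert (He2 : e * T <= D).
{ assert (H : e <= D / T) by apply Rmin_r.
  apply (Rmult_le_compat_r T) in H; [|lra].
  unfold Rdiv in H; rewrite Rmult_assoc, Rinv_l, Rmult_1_r in H by lra; lra. }
assert (Hle : b + e <= b3 * (1 - (a + e) * (b + e))).
{ assert (H : 0 <= e * b3 * (1 - e)) by (repeat apply Rmult_le_pos; lra).
  unfold D, T in He2; lra. }
exists (a + e), (b + e); repeat split; try lra.
(* If [b1 b2 >= 1], the right side of [Hle] would be nonpositive and the left side positive. *)
destruct (Rlt_le_dec ((a + e) * (b + e)) 1) as [H|H]; auto.
assert (0 <= b3 * ((a + e) * (b + e) - 1)) by (apply Rmult_le_pos; lra); lra.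
Qed.

Lemma entire_of_bound (u : coefs) M b : 0 <= b ->
  (forall k, INR (fact k) * Cmod (u k) <= M * b ^ k) -> entire u.
Proof.
intros Hb H z; apply Cex_series_le with (fun k => M * (exp_coef b k * Cmod z ^ k)).
- exists (M * exp (b * Cmod z)).
  exact (is_series_scal M _ _ (is_series_exp_coef b (Cmod z))).
- intros k; rewrite Cmod_mult, Cmod_Cpow, <- Rmult_assoc.
  apply Rmult_le_compat_r; [apply pow_le, Cmod_ge_0|].
  assert (F := INR_fact_pos k).
  apply (Rmult_le_reg_l (INR (fact k))); auto.
  eapply Rle_trans; [apply H|]; right; unfold exp_coef; field; lra.
Qed.

(** The absolutely convergent series of [phi] and [f] dominates: [V <= v], [W <= w] and [dcoef >= 0]
    put the terms of all approximants below those of the limit. *)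
Lemma Dop_in_Lplus theta (phi f : coefs) : 0 <= theta ->
  (forall n, ex_series (fun k => Cmod (Dop_term theta phi f n k)) /\
             is_series (Dop_term theta phi f n) (Dop theta phi f n)) ->
  in_Lplus phi -> in_Lplus f -> in_Lplus (Dop theta phi f).
Proof.
intros Ht HD Hphi Hf.
destruct (Lplus_approx phi Hphi) as [c [v [V [E1 [FV [BV LV]]]]]].
destruct (Lplus_approx f Hf) as [d [w [W [E2 [FW [BW LW]]]]]].
assert (ET : forall n k, Dop_term theta phi f n k =
               Cmult (Cmult c d) (RtoC (real_Dop_term theta v w n k))).
{ intros n k; unfold Dop_term, real_Dop_term; rewrite E1, E2, !RtoC_mult; ring. }
(* Summability of the real series is read off the complex one by dividing by [|c d|]; if [c d = 0],
   the result is the zero function. *)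
destruct (Ceq_dec (Cmult c d) (RtoC 0)) as [Hcd|Hcd].
{ apply in_Lplus_zero; intros n.
  apply (Cis_series_unique _ _ _ (proj2 (HD n))).
  apply is_series_ext with (fun _ => RtoC 0).
  - intros k; rewrite ET, Hcd; symmetry; apply Cmult_0_l.
  - apply (is_series_RtoC (fun _ => 0) 0).
    apply filterlim_ext with (fun _ => 0); [|apply filterlim_const].
    intros k; rewrite sum_n_const; symmetry; apply Rmult_0_r. }
assert (Hm : 0 < Cmod (Cmult c d)) by now apply Cmod_gt_0.
assert (Hv : forall k, 0 <= v k) by (intros k; specialize (BV O k); lra).
assert (Hw : forall k, 0 <= w k) by (intros k; specialize (BW O k); lra).
assert (Hex : forall n, ex_series (real_Dop_term theta v w n)).
{ intros n; apply Rex_series_le with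
    (fun k => / Cmod (Cmult c d) * Cmod (Dop_term theta phi f n k)).
  - intros k; rewrite ET, (Cmod_mult (Cmult c d)), Cmod_R; right; field; lra.
  - destruct (proj1 (HD n)) as [l Hl].
    exists (/ Cmod (Cmult c d) * l); exact (is_series_scal _ _ l Hl). }
replace (Dop theta phi f) with (fun n => Cmult (Cmult c d) (RtoC (real_Dop theta v w n))).
2:{ apply functional_extensionality; intros n.
  apply (Cis_series_unique (Dop_term theta phi f n)); [|apply HD].
  eapply is_series_ext; [intros k; symmetry; apply ET|].
  exact (is_series_scal (Cmult c d) _ _ (is_series_RtoC _ _ (Series_correct _ (Hex n)))). }
assert (Hle : forall m n k, 0 <= real_Dop_term theta (V m) (W m) n k <= real_Dop_term theta v w n k).
{ intros m n k; unfold real_Dop_term; assert (Hd := dcoef_pos theta k n Ht).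
  destruct (BV m k); destruct (BW m (n + k)%nat); split.
  - apply Rmult_le_pos; auto; now apply Rmult_le_pos.
  - apply Rmult_le_compat_r; auto; now apply Rmult_le_compat. }
apply rooted_limit_Lplus with (fun m => real_Dop theta (V m) (W m)).
- intros m; now apply rooted_real_Dop.
- intros m n; split.
  + assert (H := Series_le (fun _ => 0 * 0) (real_Dop_term theta (V m) (W m) n)).
    rewrite Series_scal_l, !Rmult_0_l in H; apply H.
    * intros k; split; [lra|apply Hle].
    * now apply real_Dop_term_ex_series.
  + apply Series_le; auto.
- intros n; apply (Series_dominated _ _ (real_Dop_term theta v w n)); auto.
  + intros m k; rewrite Rabs_right; [apply Hle|apply Rle_ge, Hle].
  + intros k; unfold real_Dop_term.
    apply is_lim_seq_mult'; [|apply is_lim_seq_const].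
    now apply is_lim_seq_mult'.
Qed.

Lemma CSeries_is_series_unique (a : nat -> C) l : is_series a l -> CSeries a = l.
Proof.
intros H; apply Cis_series in H; destruct H as [H1 H2]; unfold CSeries.
rewrite (is_series_unique _ _ H1), (is_series_unique _ _ H2); now destruct l.
Qed.

(** Bilinearity, with [phi0(Delta) f] as intermediate point; convergence of the series for [phi],
    [f] follows from that of the three others. *)
Lemma Dop_sub theta (phi f phi0 f0 : coefs) n :
  ex_series (Dop_term theta (csub phi phi0) f n) ->
  ex_series (Dop_term theta phi0 (csub f f0) n) ->
  ex_series (Dop_term theta phi0 f0 n) ->
  Cminus (Dop theta phi f n) (Dop theta phi0 f0 n) =
  Cplus (Dop theta (csub phi phi0) f n) (Dop theta phi0 (csub f f0) n).
Proof.
intros [l1 H1] [l2 H2] [l3 H3].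
assert (H : is_series (Dop_term theta phi f n) (Cplus (Cplus l1 l2) l3)).
{ eapply is_series_ext;
    [|exact (is_series_plus _ _ _ _ (is_series_plus _ _ _ _ H1 H2) H3)].
  intros k; change (@eq C
    (Cplus (Cplus (Dop_term theta (csub phi phi0) f n k)
      (Dop_term theta phi0 (csub f f0) n k)) (Dop_term theta phi0 f0 n k))
    (Dop_term theta phi f n k)).
  unfold Dop_term, csub; ring. }
unfold Dop.
rewrite (CSeries_is_series_unique _ _ H), (CSeries_is_series_unique _ _ H1),
  (CSeries_is_series_unique _ _ H2), (CSeries_is_series_unique _ _ H3).
change (@eq C (Cminus (Cplus (Cplus l1 l2) l3) l3) (Cplus l1 l2)); ring.
Qed.

Theorem theorem1p3 (theta a b : R) :
  0 <= theta -> 0 <= a -> 0 <= b -> a * b < 1 ->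
  let c := b / (1 - a * b) in
  (forall phi f : coefs, in_Lplus_a a phi -> in_Lplus_a b f ->
     (forall n : nat, ex_series (Dop_term theta phi f n)) /\
     in_Lplus_a c (Dop theta phi f))
  /\
  (forall phi0 f0 : coefs, in_Lplus_a a phi0 -> in_Lplus_a b f0 ->
     forall (b3 eps : R), c < b3 -> 0 < eps ->
     exists (b1 b2 delta : R), a < b1 /\ b < b2 /\ 0 < delta /\
       forall phi f : coefs, in_Lplus_a a phi -> in_Lplus_a b f ->
         Rbar_lt (normb b1 (csub phi phi0)) (Finite delta) ->
         Rbar_lt (normb b2 (csub f f0)) (Finite delta) ->
         Rbar_lt (normb b3 (csub (Dop theta phi f) (Dop theta phi0 f0))) (Finite eps)).
Proof.
intros Ht Ha Hb Hab c.
destruct (INR_unbounded theta) as [m Hm]; apply Rlt_le in Hm.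
split.
- intros phi f [Lphi [_ Aphi]] [Lf [_ Af]].
  assert (Hbd : forall b3, c < b3 ->
    (forall n, ex_series (fun k => Cmod (Dop_term theta phi f n k)) /\
               is_series (Dop_term theta phi f n) (Dop theta phi f n)) /\
    0 < b3 /\ exists M, forall n, INR (fact n) * Cmod (Dop theta phi f n) <= M * b3 ^ n).
  { intros b3 H3.
    destruct (radius_choice a b b3 Ha Hb Hab H3) as [b1 [b2 [H1 [H2 [H12 [H23 H0]]]]]].
    destruct (normb_finite_bound b1 phi) as [_ B1]; [lra|auto|].
    destruct (normb_finite_bound b2 f) as [_ B2]; [lra|auto|].
    assert (P1 : 0 < b1) by lra; assert (P2 : 0 < b2) by lra.
    split; [|split; [auto|]].
    - intros n.
      destruct (Dop_term_series theta b1 b2 _ _ m phi f Ht Hm P1 P2 H12 B1 B2 n)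
        as [X1 [X2 _]]; auto.
    - eexists; exact (Dop_bound theta b1 b2 _ _ m phi f Ht Hm P1 P2 H12 B1 B2 b3 H23). }
  (* [c + 1] stands for any radius above [c]: convergence and entireness need just one. *)
  destruct (Hbd (c + 1)) as [HD [H0 [M HM]]]; [lra|].
  split; [intros n; eexists; apply HD|].
  split; [now apply Dop_in_Lplus|].
  split; [apply (entire_of_bound _ M (c + 1)); auto; lra|].
  intros b3 H3; destruct (Hbd b3 H3) as [_ [H0' [M' HM']]].
  now apply bound_normb_finite with M'.
- intros phi0 f0 [_ [_ Aphi0]] [_ [_ Af0]] b3 eps H3 Heps.
  destruct (radius_choice a b b3 Ha Hb Hab H3) as [b1 [b2 [H1 [H2 [H12 [H23 H0]]]]]].
  assert (P1 : 0 < b1) by lra; assert (P2 : 0 < b2) by lra.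
  destruct (normb_finite_bound b1 phi0) as [M0p B1]; [lra|auto|].
  destruct (normb_finite_bound b2 f0) as [N0p B2]; [lra|auto|].
  set (M0 := real (normb b1 phi0)) in *; set (N0 := real (normb b2 f0)) in *.
  set (L := (/ (1 - b1 * b2)) ^ m).
  assert (HL : 0 < L) by (apply pow_lt, Rinv_0_lt_compat; lra).
  (* The difference will be bounded by [L (delta (N0 + delta) + M0 delta) b3^n]; with [delta <= 1]
     this is at most [delta T b3^n]. *)
  set (T := L * (N0 + M0 + 1)).
  assert (HT : 0 < T) by (apply Rmult_lt_0_compat; lra).
  set (delta := Rmin 1 (eps / (2 * T))).
  assert (Hd0 : 0 < delta).
  { apply Rmin_glb_lt; [lra|]; apply Rmult_lt_0_compat; auto; apply Rinv_0_lt_compat; lra. }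
  assert (Hd1 : delta <= 1) by apply Rmin_l.
  assert (Hd2 : delta * T <= eps / 2).
  { assert (H : delta <= eps / (2 * T)) by apply Rmin_r.
    apply (Rmult_le_compat_r T) in H; [|lra].
    replace (eps / (2 * T) * T) with (eps / 2) in H by (field; lra); lra. }
  exists b1, b2, delta; split; [auto|split; [auto|split; [auto|]]].
  intros phi f _ _ Hphi Hf.
  apply Rbar_lt_le in Hphi; rewrite normb_le_iff in Hphi by auto.
  apply Rbar_lt_le in Hf; rewrite normb_le_iff in Hf by auto.
  assert (Bf : forall k, INR (fact k) * Cmod (f k) <= (N0 + delta) * b2 ^ k).
  { intros k; specialize (Hf k); specialize (B2 k).
    replace (f k) with (Cplus (f0 k) (csub f f0 k)) by (unfold csub; ring).
    assert (F := INR_fact_pos k); assert (H := Cmod_triangle (f0 k) (csub f f0 k)).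
    apply (Rmult_le_compat_l (INR (fact k))) in H; lra. }
  (* A supremum inherits only weak inequalities, so the target is [eps / 2]. *)
  apply Rbar_le_lt_trans with (Finite (eps / 2)); [|simpl; lra].
  apply normb_le_iff; auto; intros n.
  unfold csub at 1; rewrite (Dop_sub theta phi f phi0 f0 n).
  2:{ eexists; apply (Dop_term_series theta b1 b2 _ _ m _ _ Ht Hm P1 P2 H12 Hphi Bf n). }
  2:{ eexists; apply (Dop_term_series theta b1 b2 _ _ m _ _ Ht Hm P1 P2 H12 B1 Hf n). }
  2:{ eexists; apply (Dop_term_series theta b1 b2 _ _ m _ _ Ht Hm P1 P2 H12 B1 B2 n). }
  assert (Q1 := Dop_bound theta b1 b2 _ _ m _ _ Ht Hm P1 P2 H12 Hphi Bf b3 H23 n).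
  assert (Q2 := Dop_bound theta b1 b2 _ _ m _ _ Ht Hm P1 P2 H12 B1 Hf b3 H23 n).
  fold L in Q1, Q2.
  assert (F := INR_fact_pos n).
  assert (H := Cmod_triangle (Dop theta (csub phi phi0) f n) (Dop theta phi0 (csub f f0) n)).
  apply (Rmult_le_compat_l (INR (fact n))) in H; [|lra].
  assert (Hp : 0 < b3 ^ n) by now apply pow_lt.
  apply Rle_trans with (delta * T * b3 ^ n); [|apply Rmult_le_compat_r; lra].
  apply Rle_trans with ((delta * (N0 + delta) * L + M0 * delta * L) * b3 ^ n); [lra|].
  apply Rmult_le_compat_r; [lra|]; unfold T.
  assert (0 <= delta * L) by nra.
  assert (delta * L * (N0 + delta + M0) <= delta * L * (N0 + M0 + 1))
    by (apply Rmult_le_compat_l; lra).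
  lra.
Qed.
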